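(* Let $A\in\mathbb{R}^{n\times n}$ and $D\in\mathbb{R}^{n\times n}$ be such that both $A$ and $B=A+D$ are symmetric positive definite, and $D$ has rank $k$. Let $\Delta=B^{1/2}-A^{1/2}$. Then for $j\geq1$ (and integers $l\geq0$ with $j+kl\leq n$), the singular values of $\Delta$ satisfy \[ \sigma_{j+kl}(\Delta)\leq4\left[\exp\left(\frac{\pi^{2}}{2\log(4\hat{\kappa})}\right)\right]^{-2l}\sigma_{j}(\Delta), \] where \[ \hat{\kappa}=\frac{2\left(\sqrt{\|A\|_{2}+\|D\|_{2}}+\sqrt{\lambda_{\min}(A)}/2\right)}{\sqrt{\lambda_{\min}(A)}}. \]
   Context: For a symmetric positive (semi)definite matrix $M$, $M^{1/2}$ denotes its principal (positive semidefinite) square root. $\sigma_i(\cdot)$ denotes the $i$-th largest singular value, $\|\cdot\|_2$ the spectral norm, and $\lambda_{\min}(\cdot)$ the smallest eigenvalue. *)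

(* Defs.v *)
From HB Require Import structures.
From mathcomp Require Import all_boot all_order all_algebra.
From mathcomp Require Import all_classical all_reals all_analysis.
Set Implicit Arguments. Unset Strict Implicit. Unset Printing Implicit Defensive.
Import Order.TTheory GRing.Theory Num.Theory.
Local Open Scope ring_scope.

Section MatrixSpectral.
Variables (R : realType) (n : nat).

Definition symmetric (M : 'M[R]_n) : Prop := M^T = M.

Definition spd (M : 'M[R]_n) : Prop :=
  symmetric M /\ forall x : 'cV[R]_n, x != 0 -> 0 < (x^T *m M *m x) 0 0.

Definition spsd (M : 'M[R]_n) : Prop :=
  symmetric M /\ forall x : 'cV[R]_n, 0 <= (x^T *m M *m x) 0 0.

Definition is_principal_sqrt (S M : 'M[R]_n) : Prop :=
  spsd S /\ S *m S = M.

(* The eigenvalues of M counted with multiplicity, sorted in nonincreasing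
   order, when the characteristic polynomial splits over R (always the case
   for symmetric M); [::] otherwise. The sequence is unique when it exists. *)
Definition eigseq (M : 'M[R]_n) : seq R :=
  xget [::] (fun s : seq R => sorted >=%R s /\
                 char_poly M = \prod_(x <- s) ('X - x%:P)).

Definition sing_vals (M : 'M[R]_n) : seq R :=
  map Num.sqrt (eigseq (M^T *m M)).

(* sigma_j(M), 1-indexed: the j-th largest singular value *)
Definition sigma (M : 'M[R]_n) (j : nat) : R := nth 0 (sing_vals M) j.-1.

Definition norm2 (M : 'M[R]_n) : R := sigma M 1.

Definition lambda_min (M : 'M[R]_n) : R := last 0 (eigseq M).

End MatrixSpectral.

(* Main.v *)
(* Delta = B^(1/2) - A^(1/2) solves the Sylvester equation
   [(SA - a) Delta + Delta (SB + a) = D] with [a = sqrt (lambda_min A) / 2], in which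
   both coefficients have their spectrum in [[a, b]] with [b / a = kappa].  For a real
   polynomial [p] of degree at most [l] and [r (x) = p (x) / p (- x)], the matrix
   [r (SA - a) Delta r (SB + a)] differs from [Delta] by a matrix of rank at most
   [k l]; hence [sigma_(j + k l) <= M^2 sigma_j] whenever [|r| <= M] on the spectra.

   It remains to find [p] with [M <= 2 exp (- l pi^2 / (2 ln (4 kappa)))].  The best [r]
   for a finite set equioscillates at [l + 1] of its points with some level [M].
   Composing [r] on the left with a Blaschke factor doubles the degree and turns [M] into
   some [c >= M^2 / 2]; composing it on the right with the Landen map [(x + a^2 / x) / 2]
   doubles the degree, keeps [M], and turns [kappa] into some [kappa'] with
   [4 kappa' <= (4 kappa)^2].  An alternating function of degree [d] is beaten by no other
   one of degree [d] (de la Vallee Poussin), so after many compositions [M] is controlled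
   by the crude choice of zeros in geometric progression, which is asymptotically good
   enough for large [kappa]; the factor [pi^2] comes from [sum 1 / (2 k + 1)^2 = pi^2 / 8]. *)
Require Import Defs.
From HB Require Import structures.
From mathcomp Require Import all_boot all_order all_algebra.
From mathcomp Require Import complex.
From mathcomp Require Import all_classical all_reals all_analysis.
From mathcomp Require Import ring lra zify.
Set Implicit Arguments. Unset Strict Implicit. Unset Printing Implicit Defensive.
Import Order.TTheory GRing.Theory Num.Theory.
Import numFieldNormedType.Exports.
Local Open Scope ring_scope.

(** * Real symmetric matrices *)

(** Over [R[i]] the matrix is hermitian, so its spectral diagonal is real. A diagonal entry is then
    a root of the real characteristic polynomial, which gives an eigenvector over [R]. *)
Lemma symmetric_eigenvector (R : rcfType) n (S : 'M[R]_n.+1) : S^T = S ->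
  exists a, exists2 v : 'rV_n.+1, v != 0 & v *m S = a *: v.
Proof.
move=> symS; pose f : {rmorphism R -> R[i]} := real_complex R.
pose SC := map_mx f S.
have hermSC : SC \is hermsymmx.
  apply/is_hermitianmxP; rewrite expr0 scale1r.
  apply/matrixP => i j; rewrite !mxE -[in RHS]symS mxE.
  by rewrite conj_Creal //; apply/complex_realP; exists (S i j).
have /hermitian_normalmx/orthomx_spectralP := hermSC.
have /mxOverP/(_ 0 0)/complex_realP[a] := hermitian_spectral_diag_real hermSC.
have := spectral_unit SC.
move: (spectralmx SC) (spectral_diag SC) => P d Pu dE SCE.
have SCa : eigenvalue SC (f a).
  apply/eigenvalueP; exists (row 0 P).
    rewrite SCE !mulmxA -row_mul mulmxV // row1 -rowE row_diag_mx dE.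
    by rewrite -scalemxAl -rowE.
  apply/negP => /eqP r0.
  have : row 0 P *m invmx P = 0 by rewrite r0 mul0mx.
  rewrite -row_mul mulmxV // row1 => /rowP/(_ 0); rewrite !mxE !eqxx /= => /eqP.
  by rewrite oner_eq0.
move: SCa; rewrite eigenvalue_root_char -map_char_poly fmorph_root.
rewrite -eigenvalue_root_char => /eigenvalueP[v vS v0].
by exists a; exists v.
Qed.

Lemma mulmx_trE (R : pzRingType) n (w : 'rV[R]_n) :
  (w *m w^T) 0 0 = \sum_i w 0 i * w 0 i.
Proof. by rewrite mxE; apply: eq_bigr => i _; rewrite mxE. Qed.

Lemma mulmx_tr_ge0 (R : realDomainType) n (w : 'rV[R]_n) : 0 <= (w *m w^T) 0 0.
Proof. by rewrite mulmx_trE sumr_ge0 // => i _; rewrite -expr2 sqr_ge0. Qed.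

Lemma mulmx_tr_eq0 (R : realDomainType) n (w : 'rV[R]_n) :
  ((w *m w^T) 0 0 == 0) = (w == 0).
Proof.
apply/eqP/eqP => [|->]; last by rewrite mul0mx mxE.
rewrite mulmx_trE => /eqP; rewrite psumr_eq0; last first.
  by move=> i _; rewrite -expr2 sqr_ge0.
move=> /allP w0; apply/rowP => i; rewrite mxE; apply/eqP.
by have := w0 i (mem_index_enum _); rewrite -expr2 sqrf_eq0.
Qed.

(** Completes a unit vector to an orthogonal matrix by the reflection along [w = e - v], which
    exchanges [e] and [v]. The coefficient [c] is 2 over the squared length of [w], whence the
    separate case [v = e]. *)
Lemma householder (R : rcfType) n (v : 'rV[R]_n.+1) : v *m v^T = 1%:M ->
  exists2 H : 'M[R]_n.+1, H *m H^T = 1%:M & row 0 H = v.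
Proof.
move=> v1; have [->|vne] := eqVneq v (delta_mx 0 0).
  by exists 1%:M; rewrite ?trmx1 ?mul1mx // row1.
pose e : 'rV[R]_n.+1 := delta_mx 0 0.
have e1 : e *m e^T = 1%:M.
  by rewrite trmx_delta mul_delta_mx; apply/matrixP => i j; rewrite !mxE !ord1 !eqxx.
pose t := v 0 0; have [w wE] : exists w, w = e - v by exists (e - v).
have ve : v *m e^T = t%:M.
  by apply/matrixP => i j; rewrite trmx_delta -colE !mxE !ord1 mulr1n.
have ev : e *m v^T = t%:M by rewrite -[LHS]trmxK trmx_mul trmxK ve tr_scalar_mx.
have ww : w *m w^T = (2 - 2 * t)%:M.
  rewrite wE linearB /= mulmxBl !mulmxBr e1 ve ev v1 -!raddfB /=.
  by congr (_ %:M); ring.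
have t1 : 2 - 2 * t != 0.
  apply/eqP => t0; move: vne; rewrite eq_sym -subr_eq0 -/e -wE => /negP; apply.
  by rewrite -mulmx_tr_eq0 ww t0 mxE mul0rn.
pose c := 2 / (2 - 2 * t).
exists (1%:M - c *: (w^T *m w)).
  have -> : (1%:M - c *: (w^T *m w))^T = 1%:M - c *: (w^T *m w).
    by rewrite raddfB /= trmx1 linearZ /= trmx_mul trmxK.
  rewrite mulmxBl !mulmxBr !mulmx1 mul1mx -!scalemxAl -!scalemxAr.
  rewrite mulmxA -[w^T *m w *m w^T]mulmxA ww mul_mx_scalar -scalemxAl !scalerA.
  apply/matrixP => i j; rewrite !mxE; set z := \sum_(k < _) _.
  by rewrite /c; field.
rewrite rowE -/e mulmxBr mulmx1 -scalemxAr mulmxA.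
have -> : e *m w^T = (1 - t)%:M by rewrite wE linearB /= mulmxBr e1 ev -raddfB.
rewrite mul_scalar_mx scalerA (_ : c * (1 - t) = 1) ?scale1r ?opprB ?subrKC //.
  by rewrite wE opprB addrC subrK.
by rewrite /c; field.
Qed.

(** Deflation: an orthogonal change of basis whose first row is a unit eigenvector splits off a
    block of size 1, and induction diagonalises the rest. *)
Lemma symmetric_spectral (R : rcfType) n (S : 'M[R]_n) : S^T = S ->
  exists2 Q : 'M[R]_n, Q *m Q^T = 1%:M & exists d : 'rV_n, Q *m S *m Q^T = diag_mx d.
Proof.
elim: n S => [|n IH] S symS.
  by exists 1%:M; last exists 0; rewrite [LHS]flatmx0 [RHS]flatmx0.
have [a [v0 v0n v0S]] := symmetric_eigenvector symS.
pose N := (v0 *m v0^T) 0 0.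
have v0v : v0 *m v0^T = N%:M by rewrite [LHS]mx11_scalar.
have N0 : 0 < N by rewrite lt_def mulmx_tr_ge0 mulmx_tr_eq0 v0n.
pose v := (Num.sqrt N)^-1 *: v0.
have v1 : v *m v^T = 1%:M.
  rewrite /v linearZ /= -scalemxAl -scalemxAr v0v scalerA scale_scalar_mx.
  by rewrite -invfM -expr2 sqr_sqrtr ?(ltW N0) // mulVf ?gt_eqF.
have vS : v *m S = a *: v by rewrite -scalemxAl v0S !scalerA mulrC.
have [H HH rH] := householder v1.
have HTH : H^T *m H = 1%:M by apply: mulmx1C.
have [T TE0] : exists T, T = H *m S *m H^T by exists (H *m S *m H^T).
have symT : T^T = T by rewrite TE0 !trmx_mul trmxK symS mulmxA.
have rT : row 0 T = a *: delta_mx 0 0.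
  rewrite TE0 !row_mul rH vS -scalemxAl -rH -row_mul HH row1 //.
have [/= Q QQ [d Qd]] := IH (drsubmx (T : 'M[R]_(1 + n))) (etrans (trmx_drsub _) (congr1 _ symT)).
pose T' : 'M[R]_(1 + n) := T.
have TE : T' = block_mx a%:M 0 0 (drsubmx T').
  have ur : ursubmx T' = 0.
    apply/matrixP => i j; rewrite !mxE !ord1.
    have /rowP/(_ (rshift 1 j)) := rT; rewrite !mxE /= mulr0 => <-.
    by congr (T _ _); apply/val_inj.
  rewrite -[LHS]submxK; congr block_mx => //.
    apply/matrixP => i j; rewrite !mxE !ord1.
    have /rowP/(_ 0) := rT; rewrite !mxE /= mulr1 => <-.
    by congr (T _ _); apply/val_inj.
  by rewrite -[T' in LHS]symT -[dlsubmx _]trmxK trmx_dlsub trmxK ur trmx0.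
pose B : 'M[R]_(1 + n) := block_mx 1%:M 0 0 Q.
have BB : B *m B^T = 1%:M.
  rewrite /B tr_block_mx !trmx0 trmx1 mulmx_block !mulmx0 !mul0mx !addr0 !add0r mul1mx QQ.
  by rewrite -scalar_mx_block.
exists (B *m H).
  by rewrite trmx_mul mulmxA -(mulmxA B) HH mulmx1.
exists (row_mx a%:M d).
have -> : B *m H *m S *m (B *m H)^T = B *m T' *m B^T.
  by rewrite /T' TE0 trmx_mul !mulmxA.
rewrite TE.
rewrite /B tr_block_mx !trmx0 trmx1 !mulmx_block !mulmx0 !mul0mx !addr0 !add0r mul1mx mulmx1.
rewrite Qd !mul0mx.
have Ea : diag_mx (a%:M : 'rV[R]_1) = a%:M.
  by apply/matrixP => i j; rewrite !mxE !ord1 !eqxx.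
by apply: etrans (esym (diag_mx_row (a%:M : 'rV[R]_1) d)); rewrite Ea.
Qed.

(* If [x] is a unit eigenvector for the top eigenvalue, then so is [|x|],
   because it does not decrease the quadratic form. *)
Lemma perron_symmetric (R : rcfType) n (S : 'M[R]_n.+1) :
  S^T = S -> (forall i j, 0 < S i j) ->
  exists2 a, 0 < a & exists2 v : 'rV_n.+1, (forall i, 0 < v 0 i) & v *m S = a *: v.
Proof.
move=> symS S0; have [Q QQ [d Qd]] := symmetric_spectral symS.
have QTQ := mulmx1C QQ.
pose k := [arg max_(i > ord0) d 0 i]%O.
have dk i : d 0 i <= d 0 k by rewrite /k; case: arg_maxP => // m _; apply.
pose u : 'rV[R]_n.+1 := \row_i `|Q k i|.
have QkQk : \sum_i Q k i * Q k i = 1.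
  have /matrixP/(_ k k) := QQ; rewrite !mxE eqxx => h; rewrite -[RHS]h.
  by apply: eq_bigr => i _; rewrite mxE.
have SE (x : 'rV[R]_n.+1) : (x *m S *m x^T) 0 0 = \sum_j \sum_i x 0 i * S i j * x 0 j.
  by rewrite mxE; apply: eq_bigr => j _; rewrite !mxE mulr_suml.
have uS : d 0 k <= (u *m S *m u^T) 0 0.
  have : (row k Q *m S *m (row k Q)^T) 0 0 = d 0 k.
    rewrite -row_mul tr_row.
    have /matrixP/(_ k k) := Qd; rewrite !mxE eqxx mulr1n => <-.
    by apply: eq_bigr => i _; rewrite !mxE.
  rewrite !SE => <-; apply: ler_sum => j _; apply: ler_sum => i _.
  rewrite !mxE (le_trans (ler_norm _)) // !normrM (gtr0_norm (S0 _ _)) //.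
pose w := u *m Q^T.
have uw : u = w *m Q by rewrite -mulmxA QTQ mulmx1.
have ww : \sum_i w 0 i * w 0 i = 1.
  rewrite -mulmx_trE trmx_mul trmxK mulmxA -(mulmxA u) QTQ mulmx1 mulmx_trE -QkQk.
  by apply: eq_bigr => i _; rewrite !mxE -normrM ger0_norm // -expr2 sqr_ge0.
have wd : (u *m S *m u^T) 0 0 = \sum_i d 0 i * (w 0 i * w 0 i).
  rewrite uw trmx_mul mulmxA -(mulmxA w) -(mulmxA w) Qd mxE.
  by apply: eq_bigr => i _; rewrite mul_mx_diag !mxE; ring.
(* The unit vector [u] attains the maximum of the Rayleigh quotient, so it has no component outside
   the top eigenspace. *)
have w0 i : (d 0 k - d 0 i) * w 0 i = 0.
  have s0 : \sum_i (d 0 k - d 0 i) * (w 0 i * w 0 i) <= 0.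
    rewrite (eq_bigr (fun i => d 0 k * (w 0 i * w 0 i) - d 0 i * (w 0 i * w 0 i))); last first.
      by move=> j _; rewrite mulrBl.
    by rewrite sumrB -mulr_sumr ww mulr1 -wd subr_le0.
  have t0 j : 0 <= (d 0 k - d 0 j) * (w 0 j * w 0 j).
    by rewrite mulr_ge0 ?subr_ge0 // -expr2 sqr_ge0.
  have : \sum_i (d 0 k - d 0 i) * (w 0 i * w 0 i) == 0 by rewrite eq_le s0 sumr_ge0.
  rewrite psumr_eq0 // => /allP/(_ i (mem_index_enum _)) /=.
  by rewrite mulrA mulf_eq0 => /orP[/eqP //|/eqP ->]; rewrite mulr0.
have uE : u *m S = d 0 k *: u.
  rewrite uw scalemxAl -[LHS]mulmx1 -QTQ mulmxA; congr (_ *m Q).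
  rewrite -(mulmxA w) -(mulmxA w) Qd; apply/rowP => i.
  rewrite mul_mx_diag [LHS]mxE [RHS]mxE; apply/eqP.
  by rewrite eq_sym [w 0 i * _]mulrC -subr_eq0 -mulrBl w0.
have u0 i : 0 <= u 0 i by rewrite mxE.
have uS0 j : 0 < (u *m S) 0 j.
  rewrite mxE lt_def sumr_ge0 ?andbT; last by move=> i _; rewrite mulr_ge0 // ltW.
  rewrite psumr_eq0; last by move=> i _; rewrite mulr_ge0 // ltW.
  apply/negP => /allP h; have : \sum_i Q k i * Q k i = 0.
    apply: big1 => i _; have := h i (mem_index_enum _).
    by rewrite mulf_eq0 (gt_eqF (S0 _ _)) orbF mxE normr_eq0 => /eqP ->; rewrite mul0r.
  by rewrite QkQk => /eqP; rewrite oner_eq0.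
have pos j : 0 < d 0 k /\ 0 < u 0 j.
  have := uS0 j; rewrite uE mxE => h.
  have uj : 0 < u 0 j.
    by rewrite lt_def u0 andbT; apply/eqP => e; move: h; rewrite e mulr0 ltxx.
  by rewrite pmulr_lgt0 // in h.
by exists (d 0 k); [have [] := pos 0 | exists u => // i; have [] := pos i].
Qed.

(** * Alternating rational functions *)

(* Hypotheses on ring elements slow [lia] down considerably. *)
Ltac nat_lia := match goal with R : rcfType |- _ => clear dependent R; lia end.

Section Alternation.
Variable R : rcfType.
Implicit Types (p q : {poly R}) (y : nat -> R) (d : nat).

(** Nodes are total functions on [nat] of which only the values at 0, ..., d matter, hence d + 1
    nodes. *)
Definition increasing_upto d y := forall i, (i < d)%N -> y i < y i.+1.

Lemma increasing_uptoW d y i j : increasing_upto d y -> (i < j <= d)%N -> y i < y j.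
Proof.
move=> yi; elim: j => [|j IH] // /andP[]; rewrite ltnS leq_eqVlt => /orP[/eqP <-|ij] jd.
  exact: yi.
by rewrite (lt_trans (IH _)) ?yi // ij ltnW.
Qed.

Lemma increasing_upto_le d y i j : increasing_upto d y -> (i <= j <= d)%N -> y i <= y j.
Proof.
move=> yi /andP[]; rewrite leq_eqVlt => /orP[/eqP -> //|ij jd].
by rewrite ltW // (increasing_uptoW yi) // ij.
Qed.

Lemma increasing_upto_inj d y i j : increasing_upto d y -> (i <= d)%N -> (j <= d)%N ->
  i != j -> y i != y j.
Proof.
move=> yi id jd; rewrite neq_ltn => /orP[] h.
  by rewrite lt_eqF // (increasing_uptoW yi) // h.
by rewrite gt_eqF // (increasing_uptoW yi) // h.
Qed.

(** For positive nodes and the monic polynomial omega of degree d + 1 vanishing at them, [node_dist]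
    is |omega'(y_j)| and [node_sum] is |omega(- y_i)|. *)
Definition node_dist d y (j : nat) := \prod_(m < d.+1 | m != j :> nat) `|y j - y m|.
Definition node_sum d y (i : nat) := \prod_(m < d.+1) (y i + y m).

Lemma node_dist_gt0 d y j : increasing_upto d y -> (j <= d)%N -> 0 < node_dist d y j.
Proof.
move=> yi jd; apply: prodr_gt0 => m mj; rewrite normr_gt0 subr_eq0 eq_sym.
by rewrite (increasing_upto_inj yi) // -ltnS.
Qed.

Lemma increasing_upto_gt0 d y i : increasing_upto d y -> 0 < y 0%N -> (i <= d)%N -> 0 < y i.
Proof. by move=> yi y0 id; rewrite (lt_le_trans y0) // (increasing_upto_le yi). Qed.

Lemma node_sum_gt0 d y i : increasing_upto d y -> 0 < y 0%N -> (i <= d)%N ->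
  0 < node_sum d y i.
Proof.
move=> yi y0 id; apply: prodr_gt0 => m _; rewrite addr_gt0 //;
  by apply: (increasing_upto_gt0 yi) => //; rewrite -ltnS.
Qed.

Lemma sign_prod d (j : nat) : (j <= d)%N ->
  \prod_(m < d.+1 | m != j :> nat) (if (m < j)%N then -1 else 1) = (-1) ^+ j :> R.
Proof.
move=> jd; rewrite -big_mkcondr /=.
rewrite (eq_bigl (fun m : 'I_d.+1 => (m < j)%N)); last by move=> m /=; lia.
by rewrite (big_ord_narrow (leqW jd)) prodr_const card_ord.
Qed.

Lemma lagrange_upto d y p : increasing_upto d y -> (size p <= d.+1)%N ->
  p = \sum_(j < d.+1) p.[y j] *: \prod_(m < d.+1 | m != j) ((y j - y m)^-1 *: ('X - (y m)%:P)).
Proof.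
move=> yi sp.
(* The nodes are continued past [y d] by unit steps, since [lagrange_gen] takes a sequence injective
   on all of [nat]. *)
pose z i := if (i <= d)%N then y i else y d + (i - d)%:R.
have zinc i j : (i < j)%N -> z i < z j.
  rewrite /z => ij; case: (leqP j d) => jd.
    by rewrite (leq_trans (ltnW ij) jd) (increasing_uptoW yi) // ij.
  case: leqP => id.
    rewrite (le_lt_trans (increasing_upto_le yi (_ : i <= d <= d)%N)) ?id ?leqnn //.
    by rewrite ltrDl ltr0n subn_gt0.
  by rewrite ltrD2l ltr_nat ltn_sub2r.
have zinj : injective z.
  move=> i j /eqP; apply: contraTeq; rewrite neq_ltn => /orP[] /zinc h.
    by rewrite lt_eqF.
  by rewrite gt_eqF.
have zy (i : 'I_d.+1) : z i = y i by rewrite /z -ltnS ltn_ord.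
rewrite [LHS](lagrange_gen (ltn0Sn d) zinj sp); apply: eq_bigr => j _.
rewrite lagrangeE // mul_polyC zy; congr (_ *: _).
rewrite /= zy scaler_prod mul_polyC horner_prod.
rewrite prodfV; congr (_^-1 *: _).
  by apply: eq_bigr => m _; rewrite hornerXsubC zy.
by apply: eq_bigr => m _; rewrite zy.
Qed.

(** At [- y i] all d numerators of the j-th Lagrange polynomial are negative, as are d - j of its
    denominators, so its sign is (-1)^j. Up to these signs the interpolation kernel is positive. *)
Lemma horner_neg_node d y p (i : nat) :
  increasing_upto d y -> (size p <= d.+1)%N -> 0 < y 0%N -> (i <= d)%N ->
  p.[- y i] = \sum_(j < d.+1) (-1) ^+ j * p.[y j] *
     (node_sum d y i / ((y i + y j) * node_dist d y j)).
Proof.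
move=> yi sp y0 id; rewrite {1}(lagrange_upto yi sp) horner_sum; apply: eq_bigr => j _.
have jd : (j <= d)%N by rewrite -ltnS.
have yij : y i + y j != 0 by rewrite gt_eqF // addr_gt0 // (increasing_upto_gt0 yi).
rewrite hornerZ -mulrA [RHS]mulrCA; congr (_ * _); rewrite horner_prod.
have -> : node_sum d y i / ((y i + y j) * node_dist d y j) =
    (\prod_(m < d.+1 | m != j) (y i + y m)) / node_dist d y j.
  by rewrite /node_sum (bigD1 j) //= -mulf_div divff // mul1r.
rewrite -(sign_prod jd) /node_dist -prodfV -!big_split /=.
apply: eq_bigr => m mj; rewrite hornerZ hornerXsubC.
have md : (m <= d)%N by rewrite -ltnS.
have := increasing_upto_inj yi md jd mj; rewrite -subr_eq0 => ymj.
case: ltnP => mlj.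
  have h : y m < y j by rewrite (increasing_uptoW yi) // mlj.
  by rewrite gtr0_norm ?subr_gt0 //; ring.
have h : y j < y m by rewrite (increasing_uptoW yi) // ltn_neqAle eq_sym mj mlj.
by rewrite ltr0_norm ?subr_lt0 // invrN; ring.
Qed.

(* The kernel [1 / ((y_i + y_j) B_i B_j)] of the interpolation formula is
   symmetric, whence the symmetry of this form in [p] and [q]. *)
Lemma node_form_sym d y p q : increasing_upto d y -> 0 < y 0%N ->
  (size p <= d.+1)%N -> (size q <= d.+1)%N ->
  \sum_(i < d.+1) (-1) ^+ i * p.[y i] * q.[- y i] / (node_sum d y i * node_dist d y i) =
  \sum_(i < d.+1) (-1) ^+ i * q.[y i] * p.[- y i] / (node_sum d y i * node_dist d y i).
Proof.
move=> yi y0.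
have E (r s : {poly R}) : (size s <= d.+1)%N ->
  \sum_(i < d.+1) (-1) ^+ i * r.[y i] * s.[- y i] / (node_sum d y i * node_dist d y i) =
  \sum_(i < d.+1) \sum_(j < d.+1) ((-1) ^+ i * r.[y i]) * ((-1) ^+ j * s.[y j]) /
     ((y i + y j) * node_dist d y i * node_dist d y j).
  move=> ss; apply: eq_bigr => i _.
  have id : (i <= d)%N by rewrite -ltnS.
  rewrite (horner_neg_node yi ss y0 id) mulr_sumr mulr_suml; apply: eq_bigr => j _.
  have jd : (j <= d)%N by rewrite -ltnS.
  have := node_sum_gt0 yi y0 id; have := node_dist_gt0 yi id; have := node_dist_gt0 yi jd.
  have := increasing_upto_gt0 yi y0 id; have := increasing_upto_gt0 yi y0 jd.
  move: (node_dist _ _ _) (node_dist _ _ _) (node_sum _ _ _) => b a c y1 y2 b0 a0 c0.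
  by field; rewrite ?gt_eqF ?addr_gt0.
move=> sp sq; rewrite E // E // exchange_big /=; apply: eq_bigr => i _.
by apply: eq_bigr => j _; rewrite [y j + y i]addrC -[_ * node_dist d y j * _]mulrAC
  [_ * ((-1) ^+ i * _)]mulrC.
Qed.

(** Both sides of [node_form_sym] are compared with the sum of the positive weights [c i]: one is at
    least [M] times it, the other at most [mu] times it. Strict excess at a single node makes the
    inequality strict. *)
Lemma alternation_compare d y p q M mu :
  increasing_upto d y -> 0 < y 0%N -> (size p <= d.+1)%N -> (size q <= d.+1)%N ->
  (forall i, (i <= d)%N -> 0 < p.[- y i] /\ M * p.[- y i] <= (-1) ^+ i * p.[y i]) ->
  (forall i, (i <= d)%N -> 0 < q.[- y i] /\ (-1) ^+ i * q.[y i] <= mu * q.[- y i]) ->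
  M <= mu /\ forall i, (i <= d)%N -> M * p.[- y i] < (-1) ^+ i * p.[y i] -> M < mu.
Proof.
move=> yi y0 sp sq Hp Hq; have E := node_form_sym yi y0 sp sq.
pose c (i : nat) := p.[- y i] * q.[- y i] / (node_sum d y i * node_dist d y i).
have c0 (i : 'I_d.+1) : 0 < c i.
  have id : (i <= d)%N by rewrite -ltnS.
  by rewrite /c divr_gt0 ?mulr_gt0 ?node_sum_gt0 ?node_dist_gt0 //;
    [case: (Hp _ id) | case: (Hq _ id)].
have C0 : 0 < \sum_(i < d.+1) c i.
  by rewrite big_ord_recl ltr_pwDl ?c0 // sumr_ge0 // => i _; exact/ltW/(c0 (lift ord0 i)).
have L (i : 'I_d.+1) : M * c i <=
  (-1) ^+ i * p.[y i] * q.[- y i] / (node_sum d y i * node_dist d y i).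
  have id : (i <= d)%N by rewrite -ltnS.
  rewrite /c !mulrA; apply: ler_wpM2r.
    by rewrite invr_ge0 mulr_ge0 ?(ltW (node_sum_gt0 _ _ _)) ?(ltW (node_dist_gt0 _ _)).
  by apply: ler_wpM2r; [case: (Hq _ id) => /ltW | case: (Hp _ id)].
have U (i : 'I_d.+1) : (-1) ^+ i * q.[y i] * p.[- y i] / (node_sum d y i * node_dist d y i) <=
    mu * c i.
  have id : (i <= d)%N by rewrite -ltnS.
  rewrite /c !mulrA; apply: ler_wpM2r.
    by rewrite invr_ge0 mulr_ge0 ?(ltW (node_sum_gt0 _ _ _)) ?(ltW (node_dist_gt0 _ _)).
  rewrite -[X in _ <= X]mulrA [p.[_] * q.[_]]mulrC mulrA.
  by apply: ler_wpM2r; [case: (Hp _ id) => /ltW | case: (Hq _ id)].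
split.
  rewrite -(ler_pM2r C0) !mulr_sumr (le_trans (ler_sum _ (fun i _ => L i))) // E.
  exact: ler_sum.
move=> k kd Hk; rewrite -(ltr_pM2r C0) !mulr_sumr.
apply: lt_le_trans (ler_sum _ (fun i _ => U i)); rewrite -E.
rewrite (bigD1 (Ordinal (kd : (k < d.+1)%N))) //
  [X in _ < X](bigD1 (Ordinal (kd : (k < d.+1)%N))) //=.
apply: ltr_leD; last by apply: ler_sum => i _; exact: L.
rewrite /c !mulrA ltr_pM2r ?invr_gt0 ?mulr_gt0 ?node_sum_gt0 ?node_dist_gt0 //.
by rewrite ltr_pM2r //; case: (Hq _ kd).
Qed.

(** * Roots and signs of an alternating polynomial *)

(** The half-open intervals are disjoint, so a root sitting on a node is counted only once. *)
Lemma interlaced_roots d y p : p != 0 -> increasing_upto d y ->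
  (forall i, (i < d)%N -> exists2 z, y i <= z < y i.+1 & root p z) -> (d < size p)%N.
Proof.
move=> p0 yi H.
suff [rs [srs rrs urs _]] : exists rs, [/\ size rs = d, all (root p) rs, uniq rs &
    all (fun z => z < y d) rs] by rewrite -srs max_poly_roots.
elim: d yi H => [|d IH] yi H; first by exists [::].
have [|i id|rs [srs rrs urs lrs]] := IH.
- by move=> i id; apply: yi; rewrite ltnW.
- by apply: H; rewrite ltnW.
have [z /andP[yz zy] rz] := H d (ltnSn d).
exists (z :: rs); split => /=; rewrite ?srs ?rz ?zy //=.
  rewrite urs andbT; by apply/negP => /(allP lrs); rewrite ltNge yz.
by apply/allP => t /(allP lrs) td; rewrite (lt_trans td) // yi.
Qed.

Lemma root_between (a b : R) p : a < b -> p.[a] <= 0 < p.[b] ->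
  exists2 z, a <= z < b & root p z.
Proof.
move=> ab /andP[pa pb].
have pab : p.[a] <= 0 <= p.[b] by rewrite pa ltW.
have [z /andP[az zb] rz] := poly_ivt (ltW ab) pab.
exists z; rewrite // az lt_neqAle zb andbT; apply: contraTneq pb => <-.
by rewrite (rootP rz) ltxx.
Qed.

Lemma root_between_strict (a b : R) p : a < b -> p.[a] * p.[b] < 0 ->
  exists2 z, a < z < b & root p z.
Proof.
move=> ab; wlog pb : p / 0 < p.[b] => [W|].
  move=> h; case: (ltrgtP p.[b] 0) => [pb|pb|e]; last by rewrite e mulr0 ltxx in h.
    have [||z az] := W (- p); rewrite ?hornerN ?oppr_gt0 ?mulrNN //.
    by rewrite rootN; exists z.
  by apply: W.
rewrite pmulr_llt0 // => pa.
have [|z /andP[az zb] rz] := root_between ab (p := p); first by rewrite (ltW pa).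
exists z; rewrite // zb andbT lt_neqAle az andbT; apply: contraTneq pa => ->.
by rewrite (rootP rz) ltxx.
Qed.

Lemma signr_mul_lt0 (i : nat) (u v : R) : 0 < (-1) ^+ i * u -> 0 < (-1) ^+ i.+1 * v -> u * v < 0.
Proof.
rewrite exprS mulN1r -signr_odd; case: (odd i) => /=; rewrite ?expr1 ?expr0 ?mulN1r ?mul1r ?opprK;
  rewrite ?oppr_gt0 ?mulNr ?mul1r ?oppr_gt0 => u0 v0.
  by rewrite nmulr_rlt0.
by rewrite pmulr_rlt0.
Qed.

Section StrictAlternation.
Variables (d : nat) (y : nat -> R) (p : {poly R}).
Hypotheses (yi : increasing_upto d y) (sp : (size p <= d.+1)%N).
Hypothesis alt : forall i, (i <= d)%N -> 0 < (-1) ^+ i * p.[y i].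

Lemma alternation_neq0 : p != 0.
Proof. by apply/eqP => p0; have := alt (leq0n d); rewrite p0 horner0 mulr0 ltxx. Qed.

Lemma alternation_roots i : (i < d)%N -> exists2 z, y i < z < y i.+1 & root p z.
Proof.
move=> id; apply: root_between_strict; first exact: yi.
by apply: (signr_mul_lt0 (i := i)); apply: alt; rewrite // ltnW.
Qed.

(** The d gaps between nodes already hold d roots. A nonpositive value left of [y 0] would add
    another, too many for degree at most d. *)
Lemma alternation_left x : x <= y 0%N -> 0 < p.[x].
Proof.
move=> xy; rewrite ltNge; apply/negP => px.
have py : 0 < p.[y 0%N] by have := alt (leq0n d); rewrite expr0 mul1r.
have {}xy : x < y 0%N.
  by rewrite lt_neqAle xy andbT; apply: contraTneq py => <-; rewrite -leNgt.
have := @interlaced_roots d.+1 (fun i => if i is j.+1 then y j else x) p alternation_neq0.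
have /[swap]/[apply] : increasing_upto d.+1 (fun i => if i is j.+1 then y j else x).
  by case=> [|i] //=; rewrite ltnS => /yi.
move=> h; suff : (d.+1 < size p)%N by rewrite ltnNge sp.
apply: h => -[_|i]; first by apply: root_between; rewrite // px.
rewrite ltnS => /alternation_roots[z /andP[yz zy] rz]; exists z => //.
by rewrite (ltW yz).
Qed.

Lemma alternation_right x : y d < x -> 0 <= (-1) ^+ d * p.[x].
Proof.
move=> yx; rewrite leNgt; apply/negP => px.
have := @interlaced_roots d.+1 (fun i => if (i <= d)%N then y i else x) p alternation_neq0.
have /[swap]/[apply] : increasing_upto d.+1 (fun i => if (i <= d)%N then y i else x).
  move=> i id1; have [->|id] : i = d \/ (i < d)%N by lia.
    by rewrite leqnn ltnn.
  by rewrite id (ltnW id); apply: yi.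
move=> h; suff : (d.+1 < size p)%N by rewrite ltnNge sp.
apply: h => i id1; have [->|id] : i = d \/ (i < d)%N by lia.
  rewrite leqnn ltnn; have [|z /andP[yz zy] rz] := root_between_strict (p := p) yx.
    by apply: (signr_mul_lt0 (i := d)); [exact: alt | rewrite exprS mulN1r mulNr oppr_gt0].
  by exists z; rewrite // (ltW yz).
have [z /andP[yz zy] rz] := alternation_roots id; exists z => //.
by rewrite id (ltnW id) (ltW yz).
Qed.

End StrictAlternation.

(** * Equioscillation and its transformations *)

(** Says that r(x) = p(x) / p(- x) takes the values M, - M, M, ... at d + 1 increasing points of
    [a, b], written without division. *)
Definition alternates (d : nat) (a b M : R) := exists p, exists y : nat -> R,
  [/\ (size p <= d.+1)%N, increasing_upto d y, a <= y 0%N, y d <= b &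
      forall i, (i <= d)%N -> 0 < p.[- y i] /\ p.[y i] = (-1) ^+ i * M * p.[- y i]].

Lemma alternates_le d (a b M mu : R) q : 0 < a -> alternates d a b M ->
  (size q <= d.+1)%N ->
  (forall x, a <= x <= b -> 0 < q.[- x] /\ `|q.[x]| <= mu * q.[- x]) -> M <= mu.
Proof.
move=> a0 [p [y [sp yi ay yb H]]] sq Hq.
have y0 : 0 < y 0%N by rewrite (lt_le_trans a0).
have ayb i : (i <= d)%N -> a <= y i <= b.
  move=> id; rewrite (le_trans ay) ?(increasing_upto_le yi) //=.
  by rewrite (le_trans _ yb) // (increasing_upto_le yi) // id /=.
have [] // := @alternation_compare d y p q M mu yi y0 sp sq.
  move=> i id; have [p0 ->] := H i id; split => //.
  by rewrite !mulrA -exprD addnn -mul2n exprM sqrrN expr1n expr1n mul1r.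
move=> i id; have [q0 qm] := Hq _ (ayb _ id); split => //.
by rewrite (le_trans (ler_norm _)) // normrM normrX normrN1 expr1n mul1r.
Qed.

Lemma signr_sqr (i : nat) : (-1) ^+ i * (-1) ^+ i = 1 :> R.
Proof. by rewrite -exprD addnn -mul2n exprM sqrrN expr1n expr1n. Qed.

(** The new ratio is (r^2 - c) / (1 - c r^2). It equals - c at the d zeros of r between nodes, and c
    at the d + 1 nodes, where r^2 = M^2, provided (M^2 - c) / (1 - c M^2) = c. *)
Lemma alternates_blaschke d (a b M : R) : 0 < a -> 0 < M < 1 -> alternates d a b M ->
  exists2 c, 0 < c < 1 & M ^+ 2 <= 2 * c /\ alternates d.*2 a b c.
Proof.
move=> a0 /andP[M0 M1] [p [y [sp yi ay yb H]]].
have y0 : 0 < y 0%N by rewrite (lt_le_trans a0).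
have alt i : (i <= d)%N -> 0 < (-1) ^+ i * p.[y i].
  by move=> id; have [q0 ->] := H i id; rewrite !mulrA signr_sqr mul1r mulr_gt0.
pose t := Num.sqrt (1 - M ^+ 4).
have M4 : 0 <= 1 - M ^+ 4 by rewrite subr_ge0 exprn_ile1 // ltW.
have t0 : 0 <= t by apply: sqrtr_ge0.
have t2 : t ^+ 2 = 1 - M ^+ 4 by rewrite sqr_sqrtr.
have t1 : t <= 1 by rewrite -(@ler_pXn2r _ 2) ?nnegrE // t2 expr1n gerBl exprn_ge0 // ltW.
(* The smaller root of M^2 c^2 - 2 c + M^2 = 0; it is at least M^2 / 2 because [t <= 1]. *)
pose c := M ^+ 2 / (1 + t).
have c0 : 0 < c by rewrite divr_gt0 ?exprn_gt0 // ltr_wpDr.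
have M21 : M ^+ 2 < 1 by rewrite exprn_ilt1 // ltW.
have cM : c <= M ^+ 2.
  rewrite /c ler_pdivrMr ?ltr_wpDr // ler_peMr ?exprn_ge0 ?(ltW M0) //; lra.
have cE : c ^+ 2 * M ^+ 2 - 2 * c + M ^+ 2 = 0.
  have t1n : 1 + t != 0 by rewrite gt_eqF // ltr_wpDr.
  rewrite /c expr_div_n; apply: (mulIf (expf_neq0 2 t1n)).
  by field: t2.
have c1 : c < 1 by rewrite (le_lt_trans cM).
exists c; first by rewrite c0.
split; first by rewrite /c mulrA ler_pdivlMr ?ltr_wpDr //
  mulrC ler_wpM2r ?exprn_ge0 ?(ltW M0) //; lra.
have rts i : exists z, (i < d)%N -> y i < z < y i.+1 /\ root p z.
  case: (ltnP i d) => id; last by exists 0.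
  by have [z h r] := alternation_roots yi alt id; exists z.
have [z zP] := choice rts.
pose P := p ^+ 2 - c *: (p \Po (- 'X)) ^+ 2.
have PE x : P.[x] = p.[x] ^+ 2 - c * p.[- x] ^+ 2 by rewrite !hornerE horner_comp !hornerE.
(* Old nodes at even positions, zeros of [p] at odd ones. *)
pose Y n := if odd n then z n./2 else y n./2.
exists P, Y; split.
- rewrite /P (leq_trans (size_polyD _ _)) // geq_max size_polyN.
  have sz2 (q : {poly R}) : (size q <= d.+1)%N -> (size (q ^+ 2) <= d.*2.+1)%N.
    move=> sq; rewrite (leq_trans (size_poly_exp_leq _ _)) // ltnS muln2 leq_double.
    by rewrite -subn1 leq_subLR add1n.
  rewrite sz2 // (leq_trans (size_scale_leq _ _)) // sz2 //.
  by rewrite size_comp_poly2 // size_polyN size_polyX.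
- move=> n nd; rewrite /Y /= uphalf_half; case: (boolP (odd n)) => on /=.
    have /zP[/andP[]] : (n./2 < d)%N by rewrite ltn_half_double.
    by rewrite add1n.
  have /zP[/andP[]] : (n./2 < d)%N by rewrite ltn_half_double.
  by rewrite add0n.
- by rewrite /Y.
- by rewrite /Y odd_double doubleK.
- move=> n nd; rewrite !PE opprK /Y; case: (boolP (odd n)) => on.
    have nd2 : (n./2 < d)%N by clear -nd on; lia.
    have [/andP[yz _] rz] := zP _ nd2.
    have pz : 0 < p.[- z n./2].
      apply: (alternation_left yi sp alt); rewrite (le_trans _ (ltW y0)) // oppr_le0.
      by rewrite (le_trans (ltW y0)) // (le_trans _ (ltW yz)) // (increasing_upto_le yi) //= ltnW.
    rewrite (rootP rz) -signr_odd on expr1 expr0n /= mulr0 subr0 add0r.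
    by split; [rewrite exprn_gt0 | ring].
  have [|q0 qE] := H n./2; first by rewrite leq_half_double ltnW.
  rewrite -signr_odd (negbTE on) expr0 mul1r qE !exprMn sqrr_sign mul1r; split.
    rewrite mulrA -{1}[p.[_] ^+ 2]mul1r -mulrBl mulr_gt0 ?exprn_gt0 // subr_gt0.
    by rewrite mulr_ilt1 ?exprn_ge0 // ltW.
  apply/eqP; rewrite -subr_eq0; apply/eqP.
  transitivity ((c ^+ 2 * M ^+ 2 - 2 * c + M ^+ 2) * p.[- y n./2] ^+ 2); first by ring.
  by rewrite cE mul0r.
Qed.

(** The quantity w - sqrt(w^2 - a^2) equals a^2 / (w + sqrt(w^2 - a^2)), which decreases in w. It is
    the smaller preimage of w under the Landen map. *)
Lemma sqrt_gap_lt (a u v : R) : 0 < a -> a <= u -> u < v ->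
  v - Num.sqrt (v ^+ 2 - a ^+ 2) < u - Num.sqrt (u ^+ 2 - a ^+ 2).
Proof.
move=> a0 au uv; have u0 := lt_le_trans a0 au; have v0 := lt_trans u0 uv.
have gap w : a <= w -> exists2 r, r = Num.sqrt (w ^+ 2 - a ^+ 2) &
    0 <= r /\ (w - r) * (w + r) = a ^+ 2.
  move=> aw; exists (Num.sqrt (w ^+ 2 - a ^+ 2)); rewrite ?sqrtr_ge0 //; split => //.
  have w0 := le_trans (ltW a0) aw.
  by rewrite -subr_sqr sqr_sqrtr ?subKr // subr_ge0 ler_pXn2r ?nnegrE ?(ltW a0).
have ruv : Num.sqrt (u ^+ 2 - a ^+ 2) <= Num.sqrt (v ^+ 2 - a ^+ 2).
  by rewrite ler_wsqrtr // lerD2r ler_pXn2r ?nnegrE ?(ltW u0) ?(ltW v0) ?(ltW uv).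
have [ru ruE [ru0 uE]] := gap u au; have [rv rvE [rv0 vE]] := gap v (le_trans au (ltW uv)).
rewrite -ruE -rvE in ruv *; rewrite -(@ltr_pM2r _ (v + rv)) ?ltr_wpDr // vE -uE.
rewrite ltr_pM2l ?ltr_leD // -(@pmulr_lgt0 _ (u + ru)) ?ltr_wpDr // uE exprn_gt0 //.
Qed.

(** A value w >= a has the preimages w - sqrt(w^2 - a^2) and w + sqrt(w^2 - a^2) under x -> (x + a^2
    / x) / 2. The nodes lift to 2 d + 1 points, [y 0] contributing only its upper preimage, and the
    preimages of b bound the new interval. *)
Lemma alternates_landen d (a b M : R) : 0 < a -> a <= b -> alternates d a b M ->
  let s := Num.sqrt (b ^+ 2 - a ^+ 2) in alternates d.*2 (b - s) (b + s) M.
Proof.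
move=> a0 ab [p [y [sp yi ay yb H]]] s.
have y0 : 0 < y 0%N by rewrite (lt_le_trans a0).
have yge i : (i <= d)%N -> a <= y i.
  by move=> id; rewrite (le_trans ay) ?(increasing_upto_le yi).
have ygt i : (0 < i <= d)%N -> a < y i.
  by move=> id; rewrite (le_lt_trans ay) ?(increasing_uptoW yi).
pose r i := Num.sqrt (y i ^+ 2 - a ^+ 2).
have r0 i : 0 <= r i by apply: sqrtr_ge0.
have r2 i : (i <= d)%N -> r i ^+ 2 = y i ^+ 2 - a ^+ 2.
  move=> id; rewrite sqr_sqrtr // subr_ge0 ler_pXn2r ?nnegrE ?yge // ?(ltW a0) //.
  by rewrite (le_trans (ltW a0)) // yge.
have ry i : (i <= d)%N -> r i < y i.
  move=> id; have yi0 : 0 <= y i by rewrite (le_trans (ltW a0)) // yge.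
  by rewrite -(@ltr_pXn2r _ 2) ?nnegrE // r2 // gtrBl exprn_gt0.
have rinc i j : (i < j <= d)%N -> r i < r j.
  move=> ij; have jd : (j <= d)%N by case/andP: ij.
  have id : (i <= d)%N by nat_lia.
  rewrite -(@ltr_pXn2r _ 2) ?nnegrE // !r2 // ltrD2r ltr_pXn2r ?nnegrE //.
  - exact: increasing_uptoW yi _.
  - by rewrite (le_trans (ltW a0)) // yge.
  - by rewrite (le_trans (ltW a0)) // yge.
have rs : r d <= s.
  rewrite ler_wsqrtr // lerD2r ler_pXn2r ?nnegrE //.
    by rewrite (le_trans (ltW a0)) // yge.
  by rewrite (le_trans (ltW a0)).
pose G : {poly R} := 'X^2 + (a ^+ 2)%:P.
(* Composition with the Landen map, cleared of denominators by (2 x)^d. The sign (-1)^d makes [P]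
   positive at the negatives of the new nodes. *)
pose P : {poly R} := (-1) ^+ d *: \sum_(k < d.+1) p`_k *: (G ^+ k * (2 *: 'X) ^+ (d - k)).
have PE x : x != 0 -> P.[x] = (-1) ^+ d * ((2 * x) ^+ d * p.[(x ^+ 2 + a ^+ 2) / (2 * x)]).
  move=> x0; rewrite /P hornerZ horner_sum; congr (_ * _).
  rewrite (horner_coef_wide _ sp) mulr_sumr; apply: eq_bigr => k _.
  have kd : (k <= d)%N by rewrite -ltnS.
  rewrite /G hornerZ hornerM !horner_exp hornerZ hornerX hornerD hornerXn hornerC expr_div_n.
  have -> : (2 * x) ^+ d = (2 * x) ^+ (d - k) * (2 * x) ^+ k by rewrite -exprD subnK.
  have x2 : (2 * x) ^+ k != 0 by rewrite expf_neq0 // mulf_neq0 // pnatr_eq0.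
  by move: x2; set u := (2 * x) ^+ k => u0; field.
(* Lower preimages of [y d], ..., [y 1], then upper preimages of [y 0], ..., [y d]. *)
pose Y n := if (d <= n)%N then y (n - d)%N + r (n - d)%N else y (d - n)%N - r (d - n)%N.
have Y0 n : (n <= d.*2)%N -> 0 < Y n.
  move=> nd; rewrite /Y; case: leqP => dn.
    rewrite ltr_pwDl // (lt_le_trans a0) // yge //; nat_lia.
  by rewrite subr_gt0 ry //; nat_lia.
have Yy n : (n <= d.*2)%N -> exists2 i, (i <= d)%N &
    (Y n ^+ 2 + a ^+ 2) / (2 * Y n) = y i /\ (-1) ^+ d * (-1) ^+ i = (-1) ^+ n :> R.
  move=> nd; have Yn0 : 2 * Y n != 0 by rewrite mulf_neq0 ?pnatr_eq0 // gt_eqF // Y0.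
  move: Yn0; rewrite /Y; case: leqP => dn Yn0.
    exists (n - d)%N; first by nat_lia.
    split; last by rewrite -exprD subnKC.
    have h := r2 (n - d)%N; apply: (mulIf Yn0); rewrite divfK //.
    by rewrite sqrrD h; [ring | nat_lia].
  exists (d - n)%N; first by nat_lia.
  have dn2 : (d + (d - n) = 2 * (d - n) + n)%N by nat_lia.
  split; last by rewrite -exprD dn2 exprD exprM sqrrN !expr1n mul1r.
  have h := r2 (d - n)%N; apply: (mulIf Yn0); rewrite divfK //.
  by rewrite sqrrB h; [ring | nat_lia].
exists P, Y; split.
- rewrite (leq_trans (size_scale_leq _ _)) // (leq_trans (size_sum _ _ _)) //.
  apply/bigmax_leqP => k _; have kd : (k <= d)%N by rewrite -ltnS.
  rewrite (leq_trans (size_scale_leq _ _)) // (leq_trans (size_polyMleq _ _)) //.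
  have s1 : (size (G ^+ k) <= (2 * k).+1)%N.
    rewrite (leq_trans (size_poly_exp_leq _ _)) // ltnS leq_mul2r /G.
    by rewrite size_polyDl size_polyXn ?orbT // (leq_ltn_trans (size_polyC_leq1 _)).
  have s2 : (size ((2 *: 'X : {poly R}) ^+ (d - k)) <= (d - k).+1)%N.
    rewrite (leq_trans (size_poly_exp_leq _ _)) // ltnS -{2}[(d - k)%N]mul1n leq_mul2r.
    by rewrite -subn1 leq_subLR (leq_trans (size_scale_leq _ _)) ?orbT // size_polyX.
  have key u v : (u <= (2 * k).+1 -> v <= (d - k).+1 -> (u + v).-1 <= d.*2.+1)%N by nat_lia.
  exact: key s1 s2.
- move=> n nd; rewrite /Y; case: (ltngtP n d) => dn.
  + case: leqP => dn'.
      have -> : n.+1 = d by nat_lia.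
      rewrite subnn (_ : d - n = 1)%N; last by nat_lia.
      (* At the passage from lower to upper preimages, the critical point [a] separates [y 1 - r 1]
         from [y 0 + r 0]. *)
      rewrite (lt_le_trans (_ : _ < a)) // ?ler_wpDr //.
      have y1 : a < y 1%N by apply: ygt; nat_lia.
      rewrite -subr_gt0 opprB addrC -addrA.
      have : (y 1%N - a) ^+ 2 < r 1%N ^+ 2.
        rewrite r2 //; last by nat_lia.
        by rewrite -subr_gt0 (_ : _ - _ = 2 * a * (y 1%N - a)) ?mulr_gt0 ?subr_gt0 //; ring.
      rewrite ltr_pXn2r ?nnegrE ?subr_ge0 ?(ltW y1) // => h.
      lra.
    set i := (d - n.+1)%N; have -> : (d - n)%N = i.+1 by rewrite /i; nat_lia.
    have id : (i < d)%N by rewrite /i; nat_lia.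
    by apply: sqrt_gap_lt; rewrite ?yge ?yi // ltnW.
  + rewrite leqW 1?ltnW // subSn ?(ltnW dn) //.
    by rewrite ltrD ?rinc ?(increasing_uptoW yi) //; nat_lia.
  + rewrite dn leqnSn subnn subSnn ltrD ?rinc ?(increasing_uptoW yi) //; nat_lia.
- have yd : b - s <= y d - r d.
    move: yb; rewrite le_eqVlt => /predU1P[e|ltb]; first by rewrite /s /r e.
    apply: ltW.
exact: (sqrt_gap_lt a0 (yge d (leqnn d)) ltb).
  rewrite /Y subn0; case: leqP => // d0; rewrite (le_trans yd) //.
  have -> : d = 0%N by nat_lia.
  by rewrite lerD2l (le_trans (_ : _ <= 0)) ?oppr_le0.
- by rewrite /Y -addnn leq_addr addnK lerD.
- move=> n nd; have [i id [Yi si]] := Yy n nd; have Yn0 := Y0 n nd.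
  have [q0 qE] := H i id.
  have PYn : P.[- Y n] = (2 * Y n) ^+ d * p.[- y i].
    rewrite PE ?oppr_eq0 ?gt_eqF //
      sqrrN mulrN invrN mulrN Yi [(- (2 * _)) ^+ _]exprNn !mulrA signr_sqr.
    by rewrite mul1r.
  rewrite PYn PE ?gt_eqF // Yi qE -si; split; last by ring.
  by rewrite mulr_gt0 // exprn_gt0 // mulr_gt0.
Qed.

(** * Existence of equioscillating ratios *)

Lemma poly_with_values d y (u : nat -> R) : increasing_upto d y ->
  exists2 p : {poly R}, (size p <= d.+1)%N & forall i, (i <= d)%N -> p.[y i] = u i.
Proof.
move=> yi.
exists (\sum_(j < d.+1) u j *: \prod_(m < d.+1 | m != j) ((y j - y m)^-1 *: ('X - (y m)%:P))).
  rewrite (leq_trans (size_sum _ _ _)) //; apply/bigmax_leqP => j _.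
  rewrite (leq_trans (size_scale_leq _ _)) // (leq_trans (size_poly_prod_leq _ _)) //.
  have s2 m : (size ((y j - y m)^-1 *: ('X - (y m)%:P))%R <= 2)%N.
    by rewrite (leq_trans (size_scale_leq _ _)) // size_XsubC.
  have c : #|[pred m : 'I_d.+1 | m != j]| = d.
    by have := cardC1 j; rewrite card_ord.
  rewrite leq_subLR (leq_trans (_ : _ <= (\sum_(m < d.+1 | m != j) 2).+1)%N) //.
    by rewrite ltnS leq_sum.
  by rewrite sum_nat_const c; nat_lia.
move=> i id; pose i' := Ordinal (id : (i < d.+1)%N).
have lag j : (\prod_(m < d.+1 | m != j) ((y j - y m)^-1 *: ('X - (y m)%:P))).[y i] = (j == i')%:R.
  rewrite horner_prod; have [->|ji] := eqVneq j i'.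
    apply: big1 => m mi; rewrite hornerZ hornerXsubC mulVf // subr_eq0 eq_sym.
    by apply: (increasing_upto_inj yi) => //; rewrite -ltnS.
  by rewrite (bigD1 i') 1?eq_sym //= hornerZ hornerXsubC subrr mulr0 mul0r.
rewrite horner_sum (bigD1 i') //= hornerZ lag eqxx mulr1 big1 ?addr0 // => j ji.
by rewrite hornerZ lag (negbTE ji) mulr0.
Qed.

(* Perron's theorem for the kernel [1 / (y_i + y_j)], suitably rescaled. *)
Lemma alternation_on_nodes d y : increasing_upto d y -> 0 < y 0%N ->
  exists p, exists M, [/\ 0 < M, (size p <= d.+1)%N &
    forall i, (i <= d)%N -> 0 < p.[- y i] /\ p.[y i] = (-1) ^+ i * M * p.[- y i]].
Proof.
move=> yi y0.
pose A i := Num.sqrt (node_sum d y i); pose B i := Num.sqrt (node_dist d y i).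
have A0 i : (i <= d)%N -> 0 < A i by move=> id; rewrite sqrtr_gt0 node_sum_gt0.
have B0 i : (i <= d)%N -> 0 < B i by move=> id; rewrite sqrtr_gt0 node_dist_gt0.
have AE i : (i <= d)%N -> node_sum d y i = A i ^+ 2.
  by move=> id; rewrite sqr_sqrtr // ltW // node_sum_gt0.
have BE i : (i <= d)%N -> node_dist d y i = B i ^+ 2.
  by move=> id; rewrite sqr_sqrtr // ltW // node_dist_gt0.
have yp i : (i <= d)%N -> 0 < y i by move=> id; exact: (increasing_upto_gt0 yi).
have le (i : 'I_d.+1) : (i <= d)%N by rewrite -ltnS.
(* The kernel of [horner_neg_node], conjugated by the diagonal [A i * B i] to become symmetric. Its
   Perron eigenvalue [t] gives the level [t^-1]. *)
pose S : 'M[R]_d.+1 := \matrix_(i, j) (A i / B i * (A j / B j) / (y i + y j)).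
have [||t t0 [x x0 xS]] := @perron_symmetric R d S.
- by apply/matrixP => i j; rewrite !mxE [y j + _]addrC [A j / B j * _]mulrC.
- by move=> i j; rewrite mxE !(divr_gt0, mulr_gt0) ?A0 ?B0 ?addr_gt0 ?yp.
have [v vE] : exists v : nat -> R, forall i, v i = A i * B i * x 0 (inord i).
  by exists (fun i => A i * B i * x 0 (inord i)).
have vx (i : 'I_d.+1) : v i = A i * B i * x 0 i by rewrite vE inord_val.
have [p sp pv] := poly_with_values (fun i => (-1) ^+ i * t^-1 * v i) yi.
have pn i : (i <= d)%N -> p.[- y i] = v i.
  move=> id; rewrite (horner_neg_node yi sp y0 id).
  have /rowP/(_ (inord i)) := xS; rewrite [RHS]mxE [LHS]mxE => E.
  have -> : v i = A i * B i * (t^-1 * (t * x 0 (inord i))) by rewrite vE mulKf ?gt_eqF.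
  rewrite -E !mulr_sumr; apply: eq_bigr => j _.
  rewrite (pv _ (le j)) !mulrA signr_sqr mul1r mxE inordK // vx AE // BE //.
  have := A0 _ (le j); have := B0 _ (le j); have := A0 _ id; have := B0 _ id.
  have := yp _ id; have := yp _ (le j).
  move: (A i) (B i) (A j) (B j) (y i) (y j) (x 0 j) => a b a' b' u u' w u'0 u0 b0 a0 b'0 a'0.
  by field; rewrite ?gt_eqF ?addr_gt0.
exists p, t^-1; split; rewrite ?invr_gt0 // => i id.
by rewrite pn // pv // vE !mulr_gt0 ?A0 ?B0.
Qed.

(** A one-point exchange argument: among all choices of d + 1 nodes in [X], take one of largest
    level. If the ratio exceeded this level at a further point of [X], exchanging that point for a
    node would raise the level. *)
Lemma exists_alternation d (a b : R) (X : seq R) : 0 < a -> all (fun x => a <= x <= b) X ->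
  exists p, exists M, [/\ (size p <= d.+1)%N,
    forall x, x \in X -> p.[- x] != 0 /\ `|p.[x]| <= M * `|p.[- x]| &
    M = 0 \/ 0 < M /\ alternates d a b M].
Proof.
move=> a0 Xab.
pose s := sort <=%O (undup X); pose n := size s.
have sX x : (x \in s) = (x \in X) by rewrite mem_sort mem_undup.
have s_ab x : x \in s -> a <= x <= b by rewrite sX => /(allP Xab).
have srt : sorted <%O s by rewrite sort_lt_sorted undup_uniq.
have nth_lt i j : (i < j < n)%N -> s`_i < s`_j.
  move=> /andP[ij jn]; apply: (sorted_ltn_nth lt_trans) => //; rewrite inE //.
  exact: ltn_trans jn.
have [nd|dn] := leqP n d.
  (* With at most d points, a polynomial vanishing at all of them has level 0. *)
  exists (\prod_(x <- s) ('X - x%:P)), 0; split; last by left.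
    by rewrite size_prod_XsubC.
  move=> x xX; rewrite !horner_prod mul0r; split.
    rewrite prodf_seq_neq0; apply/allP => z zs /=; rewrite hornerXsubC.
    have /andP[xa _] := allP Xab _ xX; have /andP[za _] := s_ab _ zs.
    by rewrite subr_eq0 lt_eqF // (lt_trans (_ : _ < 0)) ?oppr_lt0 ?(lt_le_trans a0).
  rewrite (big_rem x) ?sX //= hornerXsubC subrr mul0r normr0 //.
(* A choice of nodes is an increasing map into the positions of the sorted list [s]; such maps form
   a finite type, so a maximal level is attained. *)
pose incr (f : {ffun 'I_d.+1 -> 'I_n}) :=
  [forall i : 'I_d.+1, forall j : 'I_d.+1, (i < j)%N ==> (f i < f j)%N].
pose yf (f : {ffun 'I_d.+1 -> 'I_n}) (i : nat) := s`_(f (inord i)).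
have yfi f : incr f -> increasing_upto d (yf f).
  move=> /forallP fi i id; rewrite /yf nth_lt // ltn_ord andbT.
  by have /forallP/(_ (inord i.+1))/implyP := fi (inord i); apply; rewrite !inordK // ltnW.
have yfab f i : a <= yf f i <= b by rewrite s_ab // mem_nth.
have yf0 f i : 0 < yf f i by have /andP[h _] := yfab f i; rewrite (lt_le_trans a0).
have /choice[pM pMP] f : exists pM : {poly R} * R, incr f -> [/\ 0 < pM.2, (size pM.1 <= d.+1)%N &
    forall i, (i <= d)%N -> 0 < pM.1.[- yf f i] /\ pM.1.[yf f i] =
      (-1) ^+ i * pM.2 * pM.1.[- yf f i]].
  case: (boolP (incr f)) => fi; last by exists (0, 0).
  by have [p [M H]] := alternation_on_nodes (yfi f fi) (yf0 f 0%N); exists (p, M).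
pose f0 : {ffun 'I_d.+1 -> 'I_n} := [ffun i => widen_ord dn i].
have f0i : incr f0 by apply/forallP => i; apply/forallP => j; apply/implyP; rewrite !ffunE.
pose f := [arg max_(g > f0 | incr g) (pM g).2]%O.
have [fi fmax] : incr f /\ forall g, incr g -> (pM g).2 <= (pM f).2.
  by rewrite /f; case: arg_maxP.
have [] := pMP f fi; have yi := yfi f fi; have yab := yfab f; have y0 := yf0 f.
move: (pM f) fmax => [p M] /= fmax M0 sp H.
set y := yf f in yi yab y0 H.
have alt i : (i <= d)%N -> 0 < (-1) ^+ i * p.[y i].
  by move=> id; have [q0 ->] := H i id; rewrite !mulrA signr_sqr mul1r mulr_gt0.
have pneg x : x \in X -> 0 < p.[- x].
  move=> /(allP Xab)/andP[ax _]; apply: (alternation_left yi sp alt).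
  by rewrite (le_trans _ (ltW (y0 0%N))) // oppr_le0 (le_trans (ltW a0)).
exists p, M; split => //; last first.
  right; split => //; exists p, y; split => //.
    by have /andP[] := yab 0%N.
  by have /andP[] := yab d.
move=> x xX; have px0 := pneg x xX; split; first by rewrite gt_eqF.
rewrite (gtr0_norm px0) leNgt; apply/negP => bad.
have /(nthP 0)[m0 m0n xE] : x \in s by rewrite sX.
pose m := Ordinal (m0n : (m0 < n)%N).
pose g i : nat := f (inord i).
have ginc i j : (i < j <= d)%N -> (g i < g j)%N.
  move=> ij; have /forallP/(_ (inord i))/forallP/(_ (inord j))/implyP := fi.
  by apply; rewrite !inordK //; case/andP: ij => // ij jd; rewrite ltnS ?(ltnW (leq_trans ij jd)).
have px : p.[x] != 0.
  by apply/eqP => e; move: bad; rewrite e normr0 ltNge mulr_ge0 // ltW.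
have gm i : (i <= d)%N -> g i != m0.
  move=> id; apply/eqP => e; have yx : y i = x by rewrite /y /yf -xE -e.
  have [q0 qE] := H i id; move: bad; rewrite -yx qE normrM normrM normrX normrN1 expr1n mul1r.
  by rewrite (gtr0_norm M0) (gtr0_norm q0) ltxx.
have yg i j : (g i < j < n)%N -> y i < s`_j by move=> h; rewrite /y /yf nth_lt.
have gy i : (m0 < g i)%N -> x < y i by move=> h; rewrite -xE /y /yf nth_lt // h ltn_ord.
have yx i : (g i < m0)%N -> y i < x by move=> h; rewrite -xE; apply: yg; rewrite h.
(* Node [k] can give way to [x] without disturbing order or signs. Outside the nodes, [k] is the
   nearest end; inside, one of the two neighbours of [x] has the sign of [p.[x]]. *)
have [k [kd kx kl kr]] : exists k, [/\ (k <= d)%N, 0 < (-1) ^+ k * p.[x],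
    (0 < k)%N -> (g k.-1 < m0)%N & (k < d)%N -> (m0 < g k.+1)%N].
  have gle i j : (i <= j <= d)%N -> (g i <= g j)%N.
    case/andP; rewrite leq_eqVlt => /predU1P[-> //|ij jd]; apply/ltnW/ginc; exact/andP.
  have [g0m|] := ltnP m0 (g 0%N).
    exists 0%N; split=> // [|d0].
      by rewrite expr0 mul1r (alternation_left yi sp alt) // ltW // gy.
    by rewrite (leq_trans g0m) // gle // d0.
  rewrite leq_eqVlt (negbTE (gm _ (leq0n d))) /= => g0m.
  have [|] := leqP m0 (g d); last first.
    move=> gdm; exists d; split => // [|d0|]; last by rewrite ltnn.
      rewrite lt_def mulf_neq0 ?signr_eq0 //=.
      by rewrite (alternation_right yi sp alt) // yx.
    by rewrite (leq_ltn_trans _ gdm) // gle // leqnn leq_pred.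
  rewrite leq_eqVlt eq_sym (negbTE (gm _ (leqnn d))) /= => mgd.
  have /ex_minnP[e me emin] : exists e, (m0 < g e)%N by exists d.
  have ed : (e <= d)%N := emin _ mgd.
  have e0 : (0 < e)%N by case: (e) me => // h; move: (ltn_trans h g0m); rewrite ltnn.
  have gem : (g e.-1 < m0)%N.
    rewrite ltn_neqAle gm ?(leq_trans (leq_pred _)) //= leqNgt; apply/negP => /emin.
    by rewrite leqNgt prednK // leqnn.
  have [kx|kx] := ltrP 0 ((-1) ^+ e.-1 * p.[x]).
    exists e.-1; split; rewrite ?(leq_trans (leq_pred _)) ?prednK // => ep.
    by rewrite (leq_ltn_trans _ gem) // gle // leq_pred (leq_trans (leq_pred _)).
  exists e; split => // [|ed'].
    rewrite -{1}(prednK e0) exprS mulN1r mulNr oppr_gt0 lt_neqAle kx andbT.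
    by rewrite mulf_neq0 ?signr_eq0.
  by rewrite (leq_trans me) // gle // leqnSn.
pose f' : {ffun 'I_d.+1 -> 'I_n} := [ffun i : 'I_d.+1 => if i == k :> nat then m else f i].
have f'i : incr f'.
  apply/forallP => i; apply/forallP => j; apply/implyP => ij; rewrite !ffunE.
  have gE (i0 : 'I_d.+1) : f i0 = g i0 :> nat by rewrite /g inord_val.
  have jd : (j <= d)%N by rewrite -ltnS.
  case: eqP => [ik|_]; case: eqP => [jk|_].
  - by move: ij; rewrite ik jk ltnn.
  - rewrite gE /= (leq_trans (kr _)) -?ik ?(leq_trans ij) //.
    by move: ij; rewrite leq_eqVlt => /predU1P[-> //|ij]; apply/ltnW/ginc/andP.
  - have k0 : (0 < k)%N by rewrite -jk (leq_ltn_trans _ ij).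
    rewrite gE /= (leq_ltn_trans _ (kl k0)) // -jk.
    have : (i <= j.-1)%N by rewrite -ltnS prednK // jk.
    rewrite leq_eqVlt => /predU1P[-> //|ij']; apply/ltnW/ginc/andP; split => //.
    by rewrite (leq_trans (leq_pred _)).
  - by rewrite !gE ginc // ij.
have y'E i : (i <= d)%N -> yf f' i = if i == k then x else y i.
  by move=> id; rewrite /yf ffunE inordK //; case: eqP.
have [M'0 sp' H'] := pMP f' f'i; have := fmax _ f'i; rewrite leNgt => /negP; apply.
(* At the new nodes [p] reaches level [M], strictly so at [x], hence the level of [f'] is larger
   than the maximal one. *)
have [||||||_] := @alternation_compare d (yf f') p (pM f').1 M (pM f').2.
- exact: yfi.
- exact: yf0.
- exact: sp.
- exact: sp'.
- move=> i id; rewrite y'E //; case: eqP => [->|_].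
    split => //; rewrite -(gtr0_norm kx) normrM normrX normrN1 expr1n mul1r; exact: ltW.
  have [q0 ->] := H i id; split => //; by rewrite !mulrA signr_sqr mul1r.
- move=> i id; have [q0 ->] := H' i id; split => //; by rewrite !mulrA signr_sqr mul1r.
move/(_ k kd); rewrite y'E // eqxx; apply.
by rewrite -(gtr0_norm kx) normrM normrX normrN1 expr1n mul1r.
Qed.
End Alternation.

(** * The sum of the inverse odd squares *)

Section Basel.
Variable R : realType.
Implicit Types x : R.

(** The inequality x <= tan x without division: sin x - x cos x vanishes at 0 and has derivative x
    sin x. *)
Lemma mulr_cos_le_sin x : 0 <= x -> x <= pi / 2 -> x * cos x <= sin x.
Proof.
move=> x0 x1; rewrite -subr_ge0.
pose f := fun x : R => sin x - x * cos x.
have df (z : R) : is_derive z 1 f (z * sin z).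
  apply: is_derive_eq; rewrite /GRing.scale /=; ring.
have -> : 0 = f 0 :> R by rewrite /f sin0 mul0r subr0.
apply: (@ger0_derive1_ndecr R f 0 (pi / 2)) => //.
  move=> z; rewrite in_itv /= => /andP[z0 z1].
  rewrite derive1E derive_val mulr_ge0 ?(ltW z0) // ltW // sin_gt0_pihalf // z0 //.
by apply: continuous_subspaceT => z; apply: differentiable_continuous; apply/derivable1_diffP.
Qed.

Definition csc2 x : R := (sin x) ^- 2.

Lemma csc2_double x : sin (x *+ 2) != 0 -> 4 * csc2 (x *+ 2) = csc2 x + csc2 (x + pi / 2).
Proof.
rewrite /csc2 sinDpihalf sin_mulr2n mulrn_eq0 /= mulf_eq0 negb_or => /andP[c0 s0].
have := cos2Dsin2 x; set c := cos x; set s := sin x => cs.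
rewrite -[RHS](mulr1 _) -?cs -mulr_natl.
have -> : s ^- 2 + c ^- 2 = (c ^+ 2 + s ^+ 2) / (c ^+ 2 * s ^+ 2) by field; rewrite c0 s0.
by rewrite cs; field; rewrite c0 s0.
Qed.

Lemma csc2_pi_sub x : csc2 (pi - x) = csc2 x.
Proof. by rewrite /csc2 sinB sinpi cospi mul0r sub0r mulN1r opprK. Qed.

Lemma csc2_le x : 0 < x -> x < pi / 2 -> csc2 x <= 1 + x ^- 2.
Proof.
move=> x0 x1; have s0 : 0 < sin x by rewrite sin_gt0_pihalf // x0.
have c0 : 0 <= cos x by rewrite cos_ge0_pihalf // (ltW x1) andbT (le_trans _ (ltW x0)) //
  oppr_le0 divr_ge0 // pi_ge0.
have h : x * cos x <= sin x by rewrite mulr_cos_le_sin // ltW.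
rewrite /csc2 -[X in X <= _]mul1r ler_pdivrMr ?exprn_gt0 // mulrDl mul1r.
rewrite -(cos2Dsin2 x) addrC lerD2l mulrC ler_pdivlMr ?exprn_gt0 // -exprMn mulrC.
by rewrite ler_pXn2r ?nnegrE ?mulr_ge0 // ltW.
Qed.

Let odd_angle n k : R := (2 * k%:R + 1) * pi / 2 ^+ n.+1.

Lemma odd_angle_bound n k : (k < 2 ^ n)%N -> 0 < odd_angle n k < pi.
Proof.
move=> kn; rewrite /odd_angle; apply/andP; split.
  by rewrite divr_gt0 ?exprn_gt0 ?mulr_gt0 ?pi_gt0 // ltr_wpDl // mulr_ge0.
rewrite ltr_pdivrMr ?exprn_gt0 // mulrC ltr_pM2l ?pi_gt0 //.
have -> : 2 * k%:R + 1 = (2 * k).+1%:R :> R by rewrite -[in RHS]natr1 natrM.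
have k2 : ((2 * k).+2 = 2 * k.+1)%N by rewrite mulnS.
by rewrite -natrX ltr_nat expnS k2 leq_mul2l.
Qed.

(** Halving an angle of level n, or halving it and adding pi / 2, gives all angles of level n + 1,
    so by [csc2_double] each level multiplies the sum by 4. *)
Lemma sum_csc2 n : \sum_(k < 2 ^ n) csc2 (odd_angle n k) = 4 ^+ n.
Proof.
elim: n => [|n IH].
  rewrite expn0 big_ord1 /odd_angle mulr0 add0r mul1r expr1 /csc2 sin_pihalf expr1n invr1 //.
rewrite exprS -IH mulr_sumr expnS mul2n -addnn big_split_ord /= -big_split /=.
apply: eq_bigr => k _.
have E : odd_angle n k = odd_angle n.+1 k *+ 2.
  rewrite -[RHS]mulr_natr /odd_angle [2 ^+ n.+2]exprS; field.
  by rewrite expf_neq0 // pnatr_eq0.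
rewrite E csc2_double -?E; last by rewrite gt_eqF // sin_gt0_pi // odd_angle_bound.
congr (_ + csc2 _); rewrite /odd_angle natrD natrX !exprS; field.
by rewrite expf_neq0 // pnatr_eq0.
Qed.

(** The symmetry x -> pi - x folds the angles onto those below pi / 2, where [csc2_le] applies. *)
Lemma sum_csc2_half n : \sum_(k < 2 ^ n) csc2 (odd_angle n.+1 k) = 2 * 4 ^+ n.
Proof.
have := sum_csc2 n.+1; rewrite expnS mul2n -addnn big_split_ord /=.
rewrite [X in _ + X = _](reindex_inj rev_ord_inj) /=.
rewrite [X in _ + X = _](eq_bigr (fun k : 'I_(2 ^ n) => csc2 (odd_angle n.+1 k))).
  by rewrite exprS; lra.
move=> k _; rewrite -csc2_pi_sub; congr csc2; rewrite /odd_angle.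
rewrite natrD natrB // natrX !exprS -[in RHS]natr1; field.
by rewrite expf_neq0 // pnatr_eq0.
Qed.

Lemma odd_basel n :
  pi ^+ 2 / 8 * (1 - (2 * 2 ^+ n)^-1) <= \sum_(k < 2 ^ n) ((2 * k%:R + 1) ^- 2 : R).
Proof.
have p0 : 0 < pi :> R by apply: pi_gt0.
have : 2 * 4 ^+ n <= \sum_(k < 2 ^ n) (1 + (odd_angle n.+1 k) ^- 2).
  rewrite -sum_csc2_half; apply: ler_sum => k _; apply: csc2_le.
    by have /andP[] : 0 < odd_angle n.+1 k < pi by rewrite odd_angle_bound //
      expnS (leq_trans (ltn_ord k)) // leq_pmull.
  rewrite /odd_angle exprS invfM mulrA [X in X < _]mulrAC ltr_pM2r ?invr_gt0 //.
  by have /andP[_] := odd_angle_bound (ltn_ord k).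
rewrite big_split /= sumr_const card_ord.
have -> : \sum_(k < 2 ^ n) (odd_angle n.+1 k) ^- 2 =
   (2 ^+ n.+2 / pi) ^+ 2 * \sum_(k < 2 ^ n) ((2 * k%:R + 1) ^- 2 : R).
  rewrite mulr_sumr; apply: eq_bigr => k _; rewrite /odd_angle.
  have : 2 * k%:R + 1 != 0 :> R by rewrite gt_eqF // ltr_wpDl // mulr_ge0.
  have : 2 ^+ n.+2 != 0 :> R by rewrite expf_neq0 // pnatr_eq0.
  have : pi != 0 :> R by rewrite gt_eqF.
  move: (@pi R) (2 ^+ n.+2 : R) (2 * k%:R + 1 : R) => P u v P0 u0 v0; field.
  by rewrite P0 u0 v0.
set s := \sum_(k < _) _ => h.
have e4 : 4 ^+ n = (2 ^+ n) ^+ 2 :> R by rewrite -exprM mulnC exprM; congr (_ ^+ n); ring.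
move: h; rewrite natrX e4 [2 ^+ n.+2]exprS [2 ^+ n.+1]exprS.
have : 0 < 2 ^+ n :> R by rewrite exprn_gt0.
move: (2 ^+ n) => u u0 h.
have u0' : u != 0 by rewrite gt_eqF.
have : pi != 0 :> R by rewrite gt_eqF.
move: (@pi R) p0 h => P p0 h pn0.
rewrite -(@ler_pM2r _ (16 * u ^+ 2 / P ^+ 2)); last by rewrite !(divr_gt0, mulr_gt0, exprn_gt0).
have -> : P ^+ 2 / 8 * (1 - (2 * u)^-1) * (16 * u ^+ 2 / P ^+ 2) = 2 * u ^+ 2 - u.
  by field; rewrite u0' pn0.
rewrite lerBlDl; apply: le_trans h _; rewrite lerD2l le_eqVlt; apply/orP; left; apply/eqP.
by field.
Qed.

End Basel.

(** * Zeros in geometric progression *)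

Section Candidate.
Variable R : realType.
Implicit Types (x w : R) (K n : nat).

(** Truncation of the series of 2 artanh w = ln ((1 + w) / (1 - w)): the difference [f] vanishes at
    0, and (1 - z^2) f'(z) = 2 z^(2 K) >= 0. *)
Lemma expR_artanh_le w K : 0 <= w -> w < 1 ->
  (1 - w) / (1 + w) <= expR (- (2 * \sum_(k < K) w ^+ (2 * k).+1 / (2 * k%:R + 1))).
Proof.
move=> w0 w1.
pose P : {poly R} := \sum_(k < K) (2 * k%:R + 1)^-1 *: 'X^((2 * k).+1).
have PE z : P.[z] = \sum_(k < K) z ^+ (2 * k).+1 / (2 * k%:R + 1).
  by rewrite horner_sum; apply: eq_bigr => k _; rewrite hornerZ hornerXn mulrC.
have P'E z : (1 - z ^+ 2) * P^`().[z] = 1 - z ^+ (2 * K).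
  have -> : P^`().[z] = \sum_(k < K) (z ^+ 2) ^+ k.
    rewrite raddf_sum horner_sum; apply: eq_bigr => k _.
    rewrite /= derivZ derivXn hornerZ hornerMn hornerXn /= -[_ *+ (2 * k).+1]mulr_natl -exprM mulrA.
    rewrite -[(2 * k).+1%:R]natr1 natrM mulVf ?mul1r // gt_eqF // ltr_wpDl // mulr_ge0 //.
  by rewrite -opprB -[1 - z ^+ _]opprB mulNr exprM -subrX1.
pose f := fun z : R => ln (1 + z) - ln (1 - z) - 2 * P.[z].
have df (z : R) : 0 <= z < 1 -> is_derive z 1 f ((1 + z)^-1 - (- (1 - z)^-1) - 2 * P^`().[z]).
  move=> /andP[z0 z1].
  have d1 : is_derive z 1 (fun z : R => ln (1 + z)) ((1 + z)^-1 * 1).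
    apply: is_derive1_comp; first by apply: is_derive1_ln; rewrite ltr_pwDl.
    by apply: is_derive_eq; rewrite add0r.
  have d2 : is_derive z 1 (fun z : R => ln (1 - z)) ((1 - z)^-1 * -1).
    apply: is_derive1_comp; first by apply: is_derive1_ln; rewrite subr_gt0.
    by apply: is_derive_eq; rewrite add0r mul1r.
  have d3 := is_derive_poly P z.
  have d4 : is_derive z 1 (fun z : R => 2 * P.[z]) (2 * P^`().[z]).
    by apply: is_derive_eq; rewrite /GRing.scale /=; ring.
  have := is_deriveB (is_deriveB d1 d2) d4.
  by rewrite mulr1 mulrN1.
have f0 : f 0 = 0 by rewrite /f addr0 subr0 subrr PE big1 ?mulr0 ?subrr // => k _;
  rewrite expr0n mul0r.
have fw : 0 <= f w.
  rewrite -f0; apply: (@ger0_derive1_ndecr R f 0 w) => //.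
  - by move=> z; rewrite in_itv /= => /andP[z0 zw]; have [] := df z _;
    rewrite // (ltW z0) (lt_trans zw).
  - move=> z; rewrite in_itv /= => /andP[z0 zw].
    have z1 := lt_trans zw w1.
    have := df z; rewrite (ltW z0) z1 => /(_ isT) dz.
    rewrite derive1E derive_val.
    have u0 : 0 < 1 - z ^+ 2 by rewrite subr_gt0 exprn_ilt1 // ltW.
    rewrite -(pmulr_rge0 _ u0) mulrBr [_ * (2 * _)]mulrCA P'E.
    have -> : (1 - z ^+ 2) * ((1 + z)^-1 - - (1 - z)^-1) = 2.
      by field; rewrite subr_eq0 !gt_eqF // ltr_pwDl ?(ltW z0).
    by rewrite mulrBr mulr1 opprB addrC subrK mulr_ge0 // exprn_ge0 // ltW.
  - apply: derivable_within_continuous => z; rewrite in_itv /= => /andP[z0 zw].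
    by have [] := df z _; rewrite // z0 (le_lt_trans zw).
have w1' : 0 < 1 - w by rewrite subr_gt0.
have w2' : 0 < 1 + w by rewrite ltr_pwDl.
rewrite -PE -[X in X <= _]lnK ?posrE ?divr_gt0 // ler_expR ln_div ?posrE //.
by move: fw; rewrite /f; lra.
Qed.

Lemma ratio_bound (x p w : R) : 0 < x -> 0 < p -> 0 <= w -> w * x <= p -> w * p <= x ->
  `|x - p| / (x + p) <= (1 - w) / (1 + w).
Proof.
move=> x0 p0 w0 h1 h2; rewrite ler_pdivrMr ?addr_gt0 // mulrAC ler_pdivlMr ?ltr_pwDl //.
by case: (lerP p x) => h; rewrite ?ger0_norm ?ltr0_norm ?subr_ge0 ?subr_lt0 //; lra.
Qed.

(** The factors are tanh((m + 1) delta / 2)^2, one for the pair of (m + 1)-st nearest points on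
    either side in a geometric grid of ratio exp(delta). *)
Definition grid_bound (delta : R) n :=
  \prod_(m < n) ((1 - expR (- (m.+1%:R * delta))) / (1 + expR (- (m.+1%:R * delta)))) ^+ 2.

Lemma prod_le_window (r : nat -> R) (N n i : nat) :
  (forall j, 0 <= r j <= 1) -> (n <= i.+1)%N -> (i.+1 + n <= N)%N ->
  \prod_(j < N) r j <= \prod_(m < n) (r (i - m)%N * r (i.+1 + m)%N).
Proof.
move=> r01 ni iN; have r0 j : 0 <= r j by have /andP[] := r01 j.
have r1 j : r j <= 1 by have /andP[] := r01 j.
rewrite -(big_mkord xpredT r) /=.
have iN1 : (i.+1 <= N)%N by rewrite (leq_trans _ iN) ?leq_addr.
have iN2 : (i.+1 - n <= N)%N by rewrite (leq_trans (leq_subr _ _)).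
rewrite (@big_cat_nat _ _ _ (i.+1 - n)) //=.
rewrite (@big_cat_nat _ _ _ i.+1 (i.+1 - n)) ?leq_subr //=.
rewrite (@big_cat_nat _ _ _ (i.+1 + n) i.+1) ?leq_addr //=.
have P0 a b : 0 <= \prod_(a <= j < b) r j by apply: prodr_ge0.
have P1 a b : \prod_(a <= j < b) r j <= 1.
  suff /andP[] : 0 <= \prod_(a <= j < b) r j <= 1 by [].
  elim/big_ind: _ => // [|u v /andP[u0 u1] /andP[v0 v1]]; first by rewrite ler01 lexx.
  by rewrite mulr_ge0 // mulr_ile1.
rewrite big_split /=.
have -> : \prod_(i.+1 - n <= j < i.+1) r j = \prod_(m < n) r (i - m)%N.
  rewrite big_nat_rev /= -[X in \prod_(X <= _ < _) _]add0n big_addn subKn // big_mkord.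
  apply: eq_bigr => m _; congr r.
  by rewrite -addSn [(m.+1 + _)%N]addnC subnDl subSS.
have -> : \prod_(i.+1 <= j < i.+1 + n) r j = \prod_(m < n) r (i.+1 + m)%N.
  rewrite -[X in \prod_(X <= _ < _) _]add0n big_addn addKn big_mkord.
  by apply: eq_bigr => m _; rewrite addnC.
set A := \prod_(_ <= _ < _) _; set B := \prod_(_ < _) _; set C := \prod_(_ < _) _;
  set D := \prod_(_ <= _ < _) _.
rewrite -[X in _ <= X]mul1r ler_pM ?P1 ?mulr_ge0 ?P0 // ?prodr_ge0 // ler_wpM2l ?prodr_ge0 //.
by rewrite -[X in _ <= X]mulr1 ler_wpM2l ?prodr_ge0 // P1.
Qed.

(** The zeros run from n steps below a to far enough past b that each x in [a, b] has n of them on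
    either side. The (m + 1)-st on a side is within a factor exp((m + 1) delta) of x, and the other
    factors are at most 1. *)
Lemma grid_candidate (a b delta : R) n N : 0 < a -> a <= b -> 0 < delta ->
  ln (b / a) / delta + (2 * n + 1)%:R <= N%:R ->
  exists2 q : {poly R}, (size q <= N.+1)%N &
    forall x, a <= x <= b -> 0 < (-1) ^+ N * q.[- x] /\
      `|q.[x]| <= grid_bound delta n * ((-1) ^+ N * q.[- x]).
Proof.
move=> a0 ab de0 HN.
pose z (i : nat) := a * expR ((i%:R - n%:R) * delta).
have z0 i : 0 < z i by rewrite mulr_gt0 // expR_gt0.
exists (\prod_(i < N) ('X - (z i)%:P)).
  rewrite size_prod_XsubC // /index_enum -enumT size_enum_ord //.
move=> x /andP[ax xb]; have x0 : 0 < x := lt_le_trans a0 ax.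
have qN : (-1) ^+ N * (\prod_(i < N) ('X - (z i)%:P)).[- x] = \prod_(i < N) (x + z i).
  rewrite -[X in (-1) ^+ X]card_ord -prodr_const horner_prod -big_split /=.
  by apply: eq_bigr => i _; rewrite hornerXsubC; ring.
rewrite qN; have D0 : 0 < \prod_(i < N) (x + z i) by apply: prodr_gt0 => i _; rewrite addr_gt0.
split => //; rewrite -ler_pdivrMr // horner_prod normr_prod -prodf_div.
pose r i := `|x - z i| / (x + z i).
have r01 i : 0 <= r i <= 1.
  rewrite /r divr_ge0 ?(ltW (addr_gt0 _ _)) //= ler_pdivrMr ?addr_gt0 // mul1r.
  by rewrite (le_trans (ler_normB _ _)) // !gtr0_norm.
rewrite (eq_bigr (fun i : 'I_N => r i)); last by move=> i _; rewrite hornerXsubC.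
pose t := ln (x / a).
have t0 : 0 <= t by rewrite ln_ge0 // ler_pdivlMr // mul1r.
have tL : t <= ln (b / a) by rewrite ler_ln ?posrE ?divr_gt0 ?(lt_le_trans a0) //
  ler_pM2r ?invr_gt0.
have xE : x = a * expR t by rewrite lnK ?posrE ?divr_gt0 // mulrC divfK // gt_eqF.
pose u := t / delta + n%:R.
have u0 : n%:R <= u by rewrite lerDr divr_ge0 // ltW.
(* The last zero not exceeding [x], found on the logarithmic scale. *)
pose i := Num.truncn u.
have /andP[iu ui] : i%:R <= u < i.+1%:R by rewrite truncn_itv // (le_trans _ u0).
have ni : (n <= i)%N by rewrite -ltnS -(ltr_nat R) (le_lt_trans u0).
have iN : (i.+1 + n <= N)%N.
  rewrite -(ler_nat R) (le_trans _ HN) //.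
  have -> : (i.+1 + n)%:R = i%:R + 1 + n%:R :> R by rewrite natrD -natr1.
  have -> : (2 * n + 1)%:R = 2 * n%:R + 1 :> R by rewrite natrD natrM.
  have : u <= ln (b / a) / delta + n%:R by rewrite lerD2r ler_pM2r ?invr_gt0.
  lra.
apply: le_trans (prod_le_window r01 (leqW ni) iN) _.
apply: ler_prod => m _; rewrite mulr_ge0 ?(andP (r01 _)).1 //= expr2.
have tu : t = (u - n%:R) * delta by rewrite /u addrK divfK // gt_eqF.
have mi : (m <= i)%N by rewrite (leq_trans _ ni) // ltnW.
have E s s' : expR (- (m.+1%:R * delta)) * (a * expR s) <= a * expR s' =
    (s <= s' + m.+1%:R * delta).
  by rewrite mulrCA ler_pM2l // -expRD ler_expR addrC lerBlDr.
have rb k : t <= (k%:R - n%:R) * delta + m.+1%:R * delta ->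
    (k%:R - n%:R) * delta <= t + m.+1%:R * delta ->
    r k <= (1 - expR (- (m.+1%:R * delta))) / (1 + expR (- (m.+1%:R * delta))).
  by move=> h1 h2; apply: ratio_bound; rewrite ?expR_ge0 // /z xE E.
have tu' : t = u * delta - n%:R * delta by rewrite tu mulrBl.
have m1 : m.+1%:R = m%:R + 1 :> R by rewrite -natr1.
have i1 : i.+1%:R = i%:R + 1 :> R by rewrite -natr1.
move: ui; rewrite i1 => ui.
have idu : i%:R * delta <= u * delta by rewrite ler_pM2r.
have udi : u * delta <= (i%:R + 1) * delta by rewrite ler_pM2r // ltW.
have md : 0 <= m%:R * delta by rewrite mulr_ge0 // ltW.
apply: ler_pM; rewrite ?(andP (r01 _)).1 //; apply: rb; rewrite tu' m1.
- by rewrite natrB //; lra.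
- by rewrite natrB //; lra.
- by rewrite natrD i1; lra.
- by rewrite natrD i1; lra.
Qed.

(** Expand each logarithm by [expR_artanh_le] with 2^j terms and exchange the sums. The sum over m
    is geometric, about 1 / ((2 k + 1) delta), and summing over k leaves the inverse odd squares. *)
Lemma grid_bound_le (delta : R) n j : 0 < delta -> 2 * 2 ^+ j * delta <= 1 ->
  grid_bound delta n <= expR (- (pi ^+ 2 / (2 * delta) * (1 - 2 * 2 ^+ j * delta) *
     (1 - expR (- (n%:R * delta))) * (1 - (2 * 2 ^+ j)^-1))).
Proof.
move=> de0 Kde; pose K := (2 ^ j)%N.
pose w m := expR (- (m.+1%:R * delta)).
pose W := \sum_(m < n) 4 * \sum_(k < K) w m ^+ (2 * k).+1 / (2 * k%:R + 1).
have gW : grid_bound delta n <= expR (- W).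
  rewrite /W -sumrN expR_sum; apply: ler_prod => m _.
  have w0 : 0 <= w m by apply: expR_ge0.
  have w1 : w m < 1 by rewrite expR_lt1 oppr_lt0 mulr_gt0.
  have t0 : 0 <= (1 - w m) / (1 + w m) by rewrite divr_ge0 ?subr_ge0 ?(ltW w1) // addr_ge0.
  rewrite exprn_ge0 //=.
  have -> : - (4 * \sum_(k < K) w m ^+ (2 * k).+1 / (2 * k%:R + 1)) =
     2 * - (2 * \sum_(k < K) w m ^+ (2 * k).+1 / (2 * k%:R + 1)) by ring.
  by rewrite expRM_natl ler_pXn2r ?nnegrE ?expR_ge0 // expR_artanh_le.
apply: le_trans gW _; rewrite ler_expR lerN2.
set e := 1 - expR _; set f := 1 - 2 * 2 ^+ j * delta.
have e0 : 0 <= e by rewrite subr_ge0 expR_le1 oppr_le0 mulr_ge0 // ltW.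
have f0 : 0 <= f by rewrite subr_ge0.
(* With c = (2 k + 1) delta and v = exp(- c), the sum is v (1 - v^n) / (1 - v), where 1 - v <= c, v
   >= 1 - c >= [f] and 1 - v^n >= [e]. *)
have gk (k : 'I_K) : f * e / ((2 * k%:R + 1) * delta) <= \sum_(m < n) w m ^+ (2 * k).+1.
  have c0 : 0 < (2 * k%:R + 1) * delta by rewrite mulr_gt0 // ltr_wpDl // mulr_ge0.
  rewrite ler_pdivrMr // [leRHS]mulrC; set c := (2 * k%:R + 1) * delta in c0 *.
  pose v := expR (- c).
  have wv m : w m ^+ (2 * k).+1 = v ^+ m.+1.
    rewrite /w /v -!expRM_natl; congr expR; rewrite /c -[(2 * k).+1%:R]natr1 natrM; ring.
  have S0 : 0 <= \sum_(m < n) w m ^+ (2 * k).+1 by apply: sumr_ge0 => m _;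
    rewrite exprn_ge0 ?expR_ge0.
  have v1 : 1 - v <= c by have := expR_ge1Dx (- c); rewrite -/v; lra.
  apply: le_trans (ler_wpM2r S0 v1).
  have -> : (1 - v) * \sum_(m < n) w m ^+ (2 * k).+1 = v * (1 - v ^+ n).
    rewrite (eq_bigr (fun m : 'I_n => v * v ^+ m)); last by move=> m _; rewrite wv exprS.
    by rewrite -mulr_sumr mulrCA -[1 - v ^+ n]opprB subrX1 -mulNr opprB.
  apply: ler_pM => //.
    have kK : 2 * k%:R + 1 <= 2 * 2 ^+ j :> R.
      have -> : 2 * k%:R + 1 = (2 * k).+1%:R :> R by rewrite -[in RHS]natr1 natrM.
      by rewrite -natrX -natrM ler_nat ltn_mul2l ltn_ord.
    rewrite /f lerBlDl; apply: le_trans (_ : c + v <= _); first by lra.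
    by rewrite lerD2r ler_pM2r.
  rewrite lerD2l lerN2 /v -expRM_natl ler_expR mulrN lerN2 ler_wpM2l //.
  by rewrite /c ler_peMl ?(ltW de0) // lerDr mulr_ge0.
have B := odd_basel R j; rewrite -/K in B.
have -> : W = 4 * \sum_(k < K) (2 * k%:R + 1)^-1 * \sum_(m < n) w m ^+ (2 * k).+1.
  rewrite /W -mulr_sumr exchange_big /=; congr (_ * _); apply: eq_bigr => k _.
  by rewrite mulr_sumr; apply: eq_bigr => m _; rewrite mulrC.
apply: (@le_trans _ _ (4 * (f * e / delta * \sum_(k < K) (2 * k%:R + 1) ^- 2))).
  have -> : pi ^+ 2 / (2 * delta) * f * e * (1 - (2 * 2 ^+ j)^-1) =
     4 * (f * e / delta * (pi ^+ 2 / 8 * (1 - (2 * 2 ^+ j)^-1))).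
    by move: (@pi R) ((2 * 2 ^+ j)^-1) => P u; field; exact: lt0r_neq0.
  by rewrite ler_pM2l // ler_wpM2l // divr_ge0 ?mulr_ge0 // ltW.
rewrite ler_pM2l // mulr_sumr; apply: ler_sum => k _.
have k0 : 0 < 2 * k%:R + 1 :> R by rewrite ltr_wpDl // mulr_ge0.
apply: le_trans (ler_wpM2l _ (gk k)); last by rewrite invr_ge0 ltW.
rewrite le_eqVlt; apply/orP; left; apply/eqP.
by move: (2 * k%:R + 1) k0 => u u0; field; rewrite !gt_eqF.
Qed.

End Candidate.

(** * The optimal level *)

Section Rate.
Variable R : realType.

(** From M^2 <= 2 c follows (M / 2)^2 <= c / 2, so M / 2 is the quantity that iterates cleanly. *)
Lemma alternates_blaschke_iter (m d : nat) (a b M : R) : 0 < a -> 0 < M < 1 ->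
  alternates d a b M ->
  exists2 c, 0 < c < 1 & (M / 2) ^+ (2 ^ m) <= c / 2 /\ alternates (2 ^ m * d) a b c.
Proof.
move=> a0 M01 H; elim: m => [|m [c c01 [Mc Hc]]].
  by exists M => //; rewrite expn0 mul1n expr1.
have [c' c'01 [cc' Hc']] := alternates_blaschke a0 c01 Hc.
exists c' => //; split; last by rewrite expnS -mulnA mul2n.
rewrite expnS mulnC exprM (le_trans (_ : _ <= (c / 2) ^+ 2)) //.
  have /andP[c0 _] := c01; have /andP[M0 _] := M01.
  by rewrite ler_pXn2r ?nnegrE ?exprn_ge0 ?divr_ge0 // ltW.
by rewrite expr_div_n; lra.
Qed.

(** One step gives (b + s) / (b - s) = ((b + s) / a)^2 <= 4 (b / a)^2, so it is 4 b / a that is at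
    most squared. *)
Lemma alternates_landen_iter (k d : nat) (a b M : R) : 0 < a -> a <= b ->
  alternates d a b M ->
  exists a' b', [/\ 0 < a', a' <= b', 4 * (b' / a') <= (4 * (b / a)) ^+ (2 ^ k) &
    alternates (2 ^ k * d) a' b' M].
Proof.
move=> a0 ab H; elim: k => [|k [a' [b' [a'0 ab' kap Hk]]]].
  by exists a, b; rewrite expn0 mul1n expr1.
have b'0 := lt_le_trans a'0 ab'.
pose s := Num.sqrt (b' ^+ 2 - a' ^+ 2).
have s0 : 0 <= s by apply: sqrtr_ge0.
have s2 : s ^+ 2 = b' ^+ 2 - a' ^+ 2.
  by rewrite sqr_sqrtr // subr_ge0 ler_pXn2r ?nnegrE // ltW.
have sb : s < b' by rewrite -(@ltr_pXn2r _ 2) ?nnegrE ?(ltW b'0) // s2 gtrBl exprn_gt0.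
exists (b' - s), (b' + s); split.
- by rewrite subr_gt0.
- lra.
- rewrite expnS mulnC exprM (le_trans (_ : _ <= (4 * (b' / a')) ^+ 2)) //; last first.
    have p1 : 0 <= 4 * (b' / a') by rewrite mulr_ge0 // divr_ge0 // ltW.
    by rewrite ler_pXn2r ?nnegrE // (le_trans p1).
  have -> : 4 * ((b' + s) / (b' - s)) = 4 * ((b' + s) / a') ^+ 2.
    congr (_ * _); have a2 : (b' - s) * (b' + s) = a' ^+ 2 by rewrite -subr_sqr s2; ring.
    rewrite expr_div_n -a2; field.
    by rewrite subr_eq0 !gt_eqF // ltr_pwDl.
  have -> : (4 * (b' / a')) ^+ 2 = 4 * ((2 * b') / a') ^+ 2 by ring.
  rewrite !expr_div_n ler_pM2l // ler_pM2r ?invr_gt0 ?exprn_gt0 //.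
  by rewrite ler_pXn2r ?nnegrE ?addr_ge0 ?mulr_ge0 ?(ltW b'0) //; lra.
by rewrite expnS -mulnA mul2n; exact: alternates_landen.
Qed.

Lemma exists_pow2_ge (u : R) : exists m, u <= 2 ^+ m.
Proof.
exists (Num.truncn u).+1; rewrite (le_trans (ltW (truncnS_gt u))) //.
by rewrite -natrX ler_nat ltnW // ltn_expl.
Qed.

(** After k Landen and m Blaschke steps the alternating function has degree 2^m 2^k d, and by
    [alternates_le] its level is at most that of the geometric grid with as many zeros. Logarithms
    are then divided by 2^m. *)
Lemma alternates_rate_eps (d : nat) (a b M eps : R) : 0 < a -> a <= b -> (0 < d)%N ->
  0 < M < 1 -> alternates d a b M -> 0 < eps < 1 ->
  d%:R * pi ^+ 2 / (2 * ln (4 * (b / a))) * (1 - eps) ^+ 3 <= - ln (M / 2) * (1 + eps).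
Proof.
move=> a0 ab d0 M01 H /andP[e0 e1]; set Lam := ln (4 * (b / a)).
have M0 : 0 < M by case/andP: M01.
have ba1 : 1 <= b / a by rewrite ler_pdivlMr // mul1r.
have ba0 : 0 < b / a := lt_le_trans ltr01 ba1.
have ba40 : 0 < 4 * (b / a) by rewrite mulr_gt0.
have Lam0 : 0 < Lam by rewrite ln_gt0 //; lra.
have dR : 1 <= d%:R :> R by rewrite ler1n.
have dR0 : 0 < d%:R :> R by rewrite ltr0n.
(* Large [j] makes the partial sum of inverse odd squares accurate, large [k] makes room for the 2 n
   + 1 extra zeros, and large [m] makes the grid step [de] small against 2^-j. *)
have [j Hj] := exists_pow2_ge eps^-1.
have [k Hk] := exists_pow2_ge ((2 * (eps^-1 * d%:R / Lam) + 6) / eps).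
have [m Hm] := exists_pow2_ge (2 * 2 ^+ j * (Lam * 2) / eps).
have [a' [b' [a'0 ab' kap Hk']]] := alternates_landen_iter k a0 ab H.
have [c c01 [Mc Hc]] := alternates_blaschke_iter m a'0 M01 Hk'.
have S1 : 1 <= 2 ^+ m :> R by rewrite exprn_ege1 // ler1n.
set S := 2 ^+ m : R in Hm S1.
have S0 : 0 < S := lt_le_trans ltr01 S1.
(* Slightly wider than [Lam / (S * d%:R)], so that the zeros covering the interval leave a share of
   the degree for those outside it. *)
pose de := Lam * (1 + eps) / (S * d%:R).
have de0 : 0 < de by rewrite divr_gt0 ?mulr_gt0 // addr_gt0.
pose n := (Num.truncn (eps^-1 / de)).+1.
have nT : eps^-1 / de <= n%:R by rewrite ltW // truncnS_gt.
have nT' : n%:R <= eps^-1 / de + 1.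
  rewrite /n -natr1 lerD2r truncn_le.
  by apply: divr_ge0; apply: ltW; rewrite ?invr_gt0.
have Kde : 2 * 2 ^+ j * de <= eps.
  rewrite /de mulrA ler_pdivrMr ?mulr_gt0 //.
  move: Hm; rewrite ler_pdivrMr // => Hm.
  have : 2 * 2 ^+ j * (Lam * (1 + eps)) <= 2 * 2 ^+ j * (Lam * 2) :> R.
    by rewrite ler_pM2l ?mulr_gt0 ?exprn_gt0 // ler_pM2l //; lra.
  move=> h; apply: le_trans h _; apply: le_trans Hm _.
  by rewrite mulrC mulrA ler_peMr ?mulr_ge0 // ltW.
have Lk : ln (b' / a') <= 2 ^+ k * Lam.
  have ba'0 : 0 < b' / a' by rewrite divr_gt0 // (lt_le_trans a'0).
  apply: (@le_trans _ _ (ln (4 * (b' / a')))).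
    have ba4 : 0 < 4 * (b' / a') by rewrite mulr_gt0.
    by rewrite ler_ln ?posrE //; lra.
  apply: (@le_trans _ _ (ln ((4 * (b / a)) ^+ (2 ^ k)))).
    have ba4 : 0 < 4 * (b' / a') by rewrite mulr_gt0.
    by rewrite ler_ln ?posrE ?exprn_gt0 //.
  by rewrite lnXn ?ba40 // -[_ *+ (2 ^ k)]mulr_natl natrX.
have HN : ln (b' / a') / de + (2 * n + 1)%:R <= (2 ^ m * (2 ^ k * d))%:R.
  rewrite natrD !natrM !natrX -/S.
  have h1 : ln (b' / a') / de <= 2 ^+ k * Lam / de by rewrite ler_pM2r ?invr_gt0.
  have E1 : 2 ^+ k * Lam / de = 2 ^+ k * S * d%:R / (1 + eps).
    rewrite /de; move: (2 ^+ k : R) => u; field.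
    by rewrite !gt_eqF // addr_gt0.
  have E2 : eps^-1 / de = (eps^-1 * d%:R / Lam) * S / (1 + eps).
    by rewrite /de; field; rewrite !gt_eqF // addr_gt0.
  rewrite E1 in h1; rewrite E2 in nT'.
  apply: (@le_trans _ _ (2 ^+ k * S * d%:R / (1 + eps) +
      (2 * (eps^-1 * d%:R / Lam * S / (1 + eps) + 1) + 1))).
    by apply: lerD => //; rewrite lerD2r ler_pM2l.
  rewrite -(@ler_pM2r _ (1 + eps)) ?addr_gt0 //.
  move: Hk; rewrite ler_pdivrMr //; set u := eps^-1 * d%:R / Lam; set v := 2 ^+ k => Hk.
  have -> : (v * S * d%:R / (1 + eps) + (2 * (u * S / (1 + eps) + 1) + 1)) * (1 + eps) =
     v * S * d%:R + 2 * u * S + 3 * (1 + eps).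
    by field; rewrite gt_eqF // addr_gt0.
  have h2 : S * (2 * u + 6) <= S * (v * eps) by rewrite ler_pM2l.
  have h3 : S * (v * eps) <= S * (v * eps) * d%:R.
    by rewrite ler_peMr // mulr_ge0 ?(ltW S0) // mulr_ge0 ?exprn_ge0 // ltW.
  lra.
have [q sq Hq] := grid_candidate a'0 ab' de0 HN.
have cg : c <= grid_bound de n.
  apply: (alternates_le a'0 Hc (q := (-1) ^+ (2 ^ m * (2 ^ k * d)) *: q)).
    by rewrite (leq_trans (size_scale_leq _ _)).
  move=> x xab; have [q0 qb] := Hq x xab; rewrite !hornerZ; split => //.
  by rewrite normrM normrX normrN1 expr1n mul1r.
have Kde1 : 2 * 2 ^+ j * de <= 1 by rewrite (le_trans Kde) // ltW.
have gb := grid_bound_le n de0 Kde1.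
have M20 : 0 < M / 2 by rewrite divr_gt0.
have : expR (S * ln (M / 2)) <= expR (- (pi ^+ 2 / (2 * de) * (1 - 2 * 2 ^+ j * de) *
     (1 - expR (- (n%:R * de))) * (1 - (2 * 2 ^+ j)^-1))).
  apply: le_trans gb; apply: le_trans cg; rewrite /S -natrX expRM_natl lnK ?posrE //.
  by apply: le_trans Mc _; have /andP[c0 _] := c01; lra.
rewrite ler_expR => key.
have g0 : 1 - eps <= 1 - (2 * 2 ^+ j)^-1.
  rewrite lerD2l lerN2 -[eps]invrK lef_pV2 ?posrE ?mulr_gt0 ?exprn_gt0 ?invr_gt0 //.
  by rewrite (le_trans Hj) // ler_peMl ?exprn_ge0 // ler1n.
have g1 : 1 - eps <= 1 - expR (- (n%:R * de)).
  rewrite lerD2l lerN2 -[eps]invrK expRN lef_pV2 ?posrE ?expR_gt0 ?invr_gt0 //.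
  move: nT; rewrite ler_pdivrMr // => nT; apply: le_trans nT _.
  by apply: le_trans (expR_ge1Dx _); rewrite lerDr.
have g2 : 1 - eps <= 1 - 2 * 2 ^+ j * de by rewrite lerD2l lerN2.
have e10 : 0 <= 1 - eps by rewrite subr_ge0 ltW.
have P0 : 0 <= pi ^+ 2 / (2 * de) by rewrite divr_ge0 ?exprn_ge0 ?pi_ge0 // mulr_ge0 // ltW.
have key2 : pi ^+ 2 / (2 * de) * (1 - eps) ^+ 3 <= - (S * ln (M / 2)).
  rewrite lerNr; apply: le_trans key _; rewrite lerN2.
  have -> : (1 - eps) ^+ 3 = (1 - eps) * (1 - eps) * (1 - eps) by ring.
  move: g0 g1 g2; move: (1 - (2 * 2 ^+ j)^-1) (1 - expR _) (1 - 2 * 2 ^+ j * de) => g f e g0 g1 g2.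
  move: (pi ^+ 2 / (2 * de)) P0 => P P0; rewrite !mulrA.
  have P1 := mulr_ge0 P0 e10; have P2 := mulr_ge0 P1 e10.
  by apply: ler_pM => //; apply: ler_pM => //; apply: ler_wpM2l.
have E : pi ^+ 2 / (2 * de) * (1 + eps) = S * (d%:R * pi ^+ 2 / (2 * Lam)).
  rewrite /de; move: (@pi R) => P; field.
  by rewrite !gt_eqF // addr_gt0.
have := ler_wpM2r (ltW (addr_gt0 ltr01 e0)) key2.
by rewrite mulrAC E -mulrN -!(mulrA S) ler_pM2l.
Qed.

(** The limit eps -> 0: were [x < c], then eps = (c - x) / (8 c) and (1 - eps)^3 >= 1 - 3 eps would
    give c - x <= 4 c eps = (c - x) / 2. *)
Lemma alternates_rate (d : nat) (a b M : R) : 0 < a -> a <= b -> (0 < d)%N ->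
  0 < M < 1 -> alternates d a b M ->
  M <= 2 * expR (- (d%:R * pi ^+ 2 / (2 * ln (4 * (b / a))))).
Proof.
move=> a0 ab d0 M01 H; have M0 : 0 < M by case/andP: M01.
set c := d%:R * _ / _.
suff cx : c <= - ln (M / 2).
  rewrite mulrC -ler_pdivrMr // -[M / 2]lnK ?posrE ?divr_gt0 // ler_expR; lra.
have x0 : 0 <= - ln (M / 2).
  rewrite oppr_ge0 ln_le0 // ler_pdivrMr //; have /andP[_] := M01; lra.
set x := - ln _ in x0 *.
have c0 : 0 <= c.
  rewrite divr_ge0 ?mulr_ge0 ?exprn_ge0 ?pi_ge0 // ln_ge0 //.
  have : 1 <= b / a by rewrite ler_pdivlMr // mul1r.
  lra.
have HE eps : 0 < eps < 1 -> c * (1 - eps) ^+ 3 <= x * (1 + eps).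
  exact: alternates_rate_eps.
clearbody c x; rewrite leNgt; apply/negP => xc.
have c1 : 0 < c := le_lt_trans x0 xc.
pose eps := (c - x) / (8 * c).
have e0 : 0 < eps by rewrite divr_gt0 ?subr_gt0 // mulr_gt0.
have e1 : eps < 1 by rewrite /eps ltr_pdivrMr ?mulr_gt0 //; lra.
have h := HE eps; rewrite e0 e1 in h; have {}h := h isT.
have E : c * eps * 8 = c - x by rewrite /eps; field; rewrite gt_eqF.
have h1 : 1 - 3 * eps <= (1 - eps) ^+ 3.
  rewrite -subr_ge0 (_ : _ - _ = eps ^+ 2 * (3 - eps)); last by ring.
  by rewrite mulr_ge0 ?exprn_ge0 ?(ltW e0) //; lra.
have h2 : c * (1 - 3 * eps) <= c * (1 - eps) ^+ 3 by rewrite ler_pM2l.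
have h3 : x * eps <= c * eps by rewrite ler_pM2r // ltW.
have h4 : 0 < c * eps by rewrite mulr_gt0.
lra.
Qed.

End Rate.

Lemma zolotarev_polynomial (R : realType) (l : nat) (a b : R) (X : seq R) :
  0 < a -> a <= b -> all (fun x => a <= x <= b) X ->
  exists2 p : {poly R}, (size p <= l.+1)%N & forall x, x \in X ->
    p.[- x] != 0 /\
    `|p.[x]| <= 2 * expR (- (l%:R * pi ^+ 2 / (2 * ln (4 * (b / a))))) * `|p.[- x]|.
Proof.
move=> a0 ab Xab; case: l => [|l].
  exists 1; first by rewrite size_poly1.
  move=> x _; rewrite !hornerC oner_neq0; split => //.
  by rewrite !mul0r oppr0 expR0 normr1; lra.
have [p [M [sp H HM]]] := exists_alternation l.+1 a0 Xab.
exists p => // x xX; have [px0 pxM] := H x xX; split => //.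
apply: le_trans pxM _; rewrite ler_wpM2r //.
case: HM => [->|[M0 HM]]; first by rewrite mulr_ge0 // expR_ge0.
apply: (alternates_rate a0 ab _ _ HM) => //; rewrite M0 /=.
have b0 := lt_le_trans a0 ab; have ba0 : 0 < b + a by rewrite addr_gt0.
apply: le_lt_trans (_ : (b - a) / (b + a) < 1); last by rewrite ltr_pdivrMr // mul1r; lra.
(* That the level is below 1 follows by comparison with the linear polynomial a - x, whose ratio is
   at most (b - a) / (b + a) in absolute value. *)
apply: (alternates_le a0 HM (q := a%:P - 'X)).
  by rewrite -opprB size_polyN size_XsubC.
move=> z /andP[az zb]; rewrite !hornerE opprK; split; first by lra.
rewrite ler0_norm ?subr_le0 // opprB mulrAC ler_pdivlMr //.
rewrite -subr_ge0 (_ : _ - _ = 2 * a * (b - z)); last by ring.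
by rewrite mulr_ge0 ?subr_ge0 // mulr_ge0 // ltW.
Qed.

(** * Singular values *)

Section Spectral.
Variable R : realType.

Definition sqnorm n (u : 'rV[R]_n) : R := (u *m u^T) 0 0.

Lemma sqnorm_sum n (u : 'rV[R]_n) : sqnorm u = \sum_i u 0 i ^+ 2.
Proof. by rewrite /sqnorm mulmx_trE; apply: eq_bigr => i _; rewrite expr2. Qed.

Lemma sqnorm_ge0 n (u : 'rV[R]_n) : 0 <= sqnorm u.
Proof. exact: mulmx_tr_ge0. Qed.

Lemma sqnorm_gt0 n (u : 'rV[R]_n) : u != 0 -> 0 < sqnorm u.
Proof. by move=> u0; rewrite lt_def sqnorm_ge0 /sqnorm mulmx_tr_eq0 u0. Qed.

Lemma sqnorm_orth n (Q : 'M[R]_n) (u : 'rV_n) : Q *m Q^T = 1%:M -> sqnorm (u *m Q) = sqnorm u.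
Proof. by move=> QQ; rewrite /sqnorm trmx_mul mulmxA -(mulmxA u) QQ mulmx1. Qed.

Lemma char_poly_orth n (Q S : 'M[R]_n) (d : 'rV_n) : Q *m Q^T = 1%:M ->
  Q *m S *m Q^T = diag_mx d -> char_poly S = \prod_i ('X - (d 0 i)%:P).
Proof.
move=> QQ Qd; transitivity (char_poly (diag_mx d)); last first.
  rewrite char_poly_trig; last by apply/is_trig_mxP => i j ij;
    rewrite mxE -val_eqE /= (ltn_eqF ij).
  by apply: eq_bigr => i _; rewrite mxE eqxx mulr1n.
rewrite /char_poly -Qd; have QC : map_mx polyC Q *m map_mx polyC Q^T = 1%:M.
  by rewrite -map_mxM QQ map_mx1.
rewrite -[LHS]mul1r -(det1 _ n) -QC det_mulmx mulrAC -!det_mulmx; congr (\det _).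
rewrite /char_poly_mx mulmxBr mulmxBl !map_mxM; congr (_ - _).
by rewrite mul_mx_scalar -scalemxAl QC scale_scalar_mx mulr1.
Qed.

(** The rows of an orthogonal diagonalisation are permuted so that the diagonal decreases. The
    sorted list of roots of a split polynomial is unique, which identifies the list chosen in
    [eigseq]. *)
Lemma spectral_sorted n (S : 'M[R]_n) : S^T = S ->
  exists2 Q : 'M[R]_n, Q *m Q^T = 1%:M & exists2 d : 'rV_n, Q *m S *m Q^T = diag_mx d &
    (forall i j : 'I_n, (i <= j)%N -> d 0 j <= d 0 i) /\ eigseq S = [seq d 0 i | i <- enum 'I_n].
Proof.
move=> symS; have [Q QQ [d Qd]] := symmetric_spectral symS.
(* Indices are sorted rather than values, so that the same permutation acts on the rows of [Q]. *)
pose s := sort (fun i j : 'I_n => d 0 j <= d 0 i) (enum 'I_n).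
have ss : size s = n by rewrite size_sort size_enum_ord.
have us : uniq s by rewrite sort_uniq enum_uniq.
pose f (i : 'I_n) : 'I_n := nth i s i.
have fE (i0 i : 'I_n) : f i = nth i0 s i by apply: set_nth_default; rewrite ss.
have finj : injective f.
  move=> i j; rewrite (fE i j) /f => /eqP; rewrite nth_uniq ?ss // => /eqP h; exact: val_inj.
pose Q' : 'M[R]_n := \matrix_(i, j) Q (f i) j; pose d' : 'rV[R]_n := \row_i d 0 (f i).
have QQ' : Q' *m Q'^T = 1%:M.
  apply/matrixP => i j; rewrite !mxE; have /matrixP/(_ (f i) (f j)) := QQ.
  rewrite !mxE (inj_eq finj) => <-; by apply: eq_bigr => k _; rewrite !mxE.
have Qd' : Q' *m S *m Q'^T = diag_mx d'.
  apply/matrixP => i j; have /matrixP/(_ (f i) (f j)) := Qd; rewrite !mxE (inj_eq finj) => <-.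
  apply: eq_bigr => k _; rewrite !mxE; congr (_ * _).
  by apply: eq_bigr => m _; rewrite mxE.
have srt : sorted (fun i j : 'I_n => d 0 j <= d 0 i) s by apply: sort_sorted => i j;
  exact: le_total.
have d'dec (i j : 'I_n) : (i <= j)%N -> d' 0 j <= d' 0 i.
  rewrite !mxE (fE i j) /f => ij.
  apply: (sorted_leq_nth (leT := fun i j : 'I_n => d 0 j <= d 0 i)) => //.
  - by move=> a b c h1 h2; exact: le_trans h2 h1.
  - by rewrite inE ss.
  - by rewrite inE ss.
exists Q' => //; exists d' => //; split => //.
have cp : char_poly S = \prod_(x <- [seq d' 0 i | i <- enum 'I_n]) ('X - x%:P).
  by rewrite (char_poly_orth QQ' Qd') big_map /index_enum -enumT.
have srt' : sorted >=%R [seq d' 0 i | i <- enum 'I_n].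
  apply/(sortedP 0) => i; rewrite size_map size_enum_ord => i1.
  have nE k : (k < n)%N -> nth 0 [seq d' 0 j | j <- enum 'I_n] k = d' 0 (insubd (Ordinal i1) k).
    move=> kn; rewrite (nth_map (Ordinal i1)) ?size_enum_ord //; congr (d' 0 _).
    by apply: val_inj; rewrite /= nth_enum_ord // insubdK.
  rewrite !nE ?(ltnW i1) //; apply: d'dec.
  have iE k : (k < n)%N -> insubd (Ordinal i1) k = k :> nat by move=> kn; rewrite val_insubd kn.
  by rewrite !iE ?(ltnW i1).
rewrite /eigseq; case: xgetP => [t -> [st ct]|/(_ [seq d' 0 i | i <- enum 'I_n])]; last by case.
apply: (sorted_eq (leT := >=%R)) => //.
- by move=> a b c h1 h2; exact: le_trans h2 h1.
- by move=> a b /andP[/= h1 h2]; apply/eqP; rewrite eq_le h1 h2.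
- by apply: prod_XsubC_eq; rewrite -ct -cp.
Qed.

Lemma sing_vals_sorted n (M : 'M[R]_n) :
  exists2 Q : 'M[R]_n, Q *m Q^T = 1%:M & exists2 d : 'rV_n,
    Q *m (M^T *m M) *m Q^T = diag_mx d &
    [/\ forall i j : 'I_n, (i <= j)%N -> d 0 j <= d 0 i, forall i, 0 <= d 0 i &
    forall i : 'I_n, sigma M i.+1 = Num.sqrt (d 0 i)].
Proof.
have [|Q QQ [d Qd [dec eigE]]] := @spectral_sorted n (M^T *m M).
  by rewrite trmx_mul trmxK.
exists Q => //; exists d => //; split => //.
  move=> i; have /matrixP/(_ i i) := Qd; rewrite [RHS]mxE eqxx mulr1n => <-.
  have -> : Q *m (M^T *m M) *m Q^T = (Q *m M^T) *m (Q *m M^T)^T.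
    by rewrite trmx_mul trmxK !mulmxA.
  by rewrite mxE sumr_ge0 // => j _; rewrite [_^T _ _]mxE -expr2 sqr_ge0.
move=> i; rewrite /sigma /sing_vals eigE -map_comp /=.
by rewrite (nth_map i) ?size_enum_ord // nth_ord_enum.
Qed.

Lemma quad_diag n (Q S : 'M[R]_n) (d : 'rV_n) (u : 'rV_n) : Q *m Q^T = 1%:M ->
  Q *m S *m Q^T = diag_mx d ->
  (u *m S *m u^T) 0 0 = \sum_i d 0 i * (u *m Q^T) 0 i ^+ 2.
Proof.
move=> QQ Qd; have QTQ := mulmx1C QQ.
have -> : u *m S *m u^T = (u *m Q^T) *m (Q *m S *m Q^T) *m (u *m Q^T)^T.
  rewrite trmx_mul trmxK !mulmxA -(mulmxA u Q^T Q) QTQ mulmx1.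
  by rewrite -(mulmxA (u *m S) Q^T Q) QTQ mulmx1.
rewrite Qd mxE; apply: eq_bigr => i _;
  rewrite mul_mx_diag [(u *m Q^T)^T _ _]mxE [X in X * _]mxE; ring.
Qed.

Lemma sqnorm_le_norm2 n (M : 'M[R]_n) (u : 'rV_n) : sqnorm (u *m M^T) <= norm2 M ^+ 2 * sqnorm u.
Proof.
have [Q QQ [d Qd [dec d0 sE]]] := sing_vals_sorted M.
have -> : sqnorm (u *m M^T) = (u *m (M^T *m M) *m u^T) 0 0.
  by rewrite /sqnorm trmx_mul trmxK !mulmxA.
rewrite (quad_diag u QQ Qd) -(@sqnorm_orth _ Q^T u) ?trmxK ?(mulmx1C QQ) // sqnorm_sum mulr_sumr.
apply: ler_sum => i _; rewrite ler_wpM2r ?sqr_ge0 //.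
case: n M u Q QQ d Qd dec d0 sE i => [|n] M u Q QQ d Qd dec d0 sE i; first by case: i.
by rewrite /norm2 (sE ord0) sqr_sqrtr // dec.
Qed.

Lemma norm2_ge0 n (M : 'M[R]_n) : 0 <= norm2 M.
Proof.
rewrite /norm2 /sigma; case: (ltnP 0 (size (sing_vals M))) => h; last by rewrite nth_default.
by rewrite /sing_vals (nth_map 0) ?sqrtr_ge0 //; rewrite size_map in h.
Qed.

(** Cauchy-Schwarz, by expanding the squared length of [u *m M^T - c *: u] with [c] the norm; the
    division by [c] leaves the case [c = 0] apart. *)
Lemma quad_le_norm2 n (M : 'M[R]_n) (u : 'rV_n) : (u *m M *m u^T) 0 0 <= norm2 M * sqnorm u.
Proof.
have h := sqnorm_le_norm2 M u; set c := norm2 M in h *.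
have c0 : 0 <= c := norm2_ge0 M.
have tr : (u *m M *m u^T) 0 0 = (u *m M^T *m u^T) 0 0.
  by rewrite -[LHS]trace_mx11 -[RHS]trace_mx11 -[in LHS]mxtrace_tr !trmx_mul trmxK mulmxA.
have E : sqnorm (u *m M^T - c *: u) =
  sqnorm (u *m M^T) - 2 * c * (u *m M *m u^T) 0 0 + c ^+ 2 * sqnorm u.
  rewrite tr; move: (u *m M^T) => w.
  have -> : (w *m u^T) 0 0 = \sum_i w 0 i * u 0 i.
    by rewrite mxE; apply: eq_bigr => i _; rewrite mxE.
  rewrite !sqnorm_sum !mulr_sumr -sumrB -big_split /=; apply: eq_bigr => i _.
  by rewrite !mxE; ring.
have := sqnorm_ge0 (u *m M^T - c *: u); rewrite E => h2.
have [c1|] := ltrP 0 c.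
  have : 2 * c * (u *m M *m u^T) 0 0 <= 2 * c * (c * sqnorm u).
    by rewrite (_ : 2 * c * (c * sqnorm u) = c ^+ 2 * sqnorm u + c ^+ 2 * sqnorm u); [lra | ring].
  by rewrite ler_pM2l // mulr_gt0.
move=> c1; have c00 : c = 0 by apply/eqP; rewrite eq_le c1 c0.
move: h; rewrite c00 expr0n /= !mul0r => h.
have /eqP : sqnorm (u *m M^T) == 0 by rewrite eq_le h sqnorm_ge0.
move=> /eqP; rewrite /sqnorm mulmx_tr_eq0 => /eqP u0.
by rewrite tr u0 mul0mx mxE.
Qed.

Lemma lambda_min_bound n (M : 'M[R]_n.+1) : M^T = M ->
  (exists2 v : 'rV[R]_n.+1, v != 0 & v *m M = lambda_min M *: v) /\
  forall u : 'rV[R]_n.+1, lambda_min M * sqnorm u <= (u *m M *m u^T) 0 0.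
Proof.
move=> symM; have [Q QQ [d Qd [dec eigE]]] := spectral_sorted symM.
have lE : lambda_min M = d 0 ord_max.
  rewrite /lambda_min eigE -nth_last size_map size_enum_ord /=.
  rewrite (nth_map ord0) ?size_enum_ord //; congr (d 0 _); apply: val_inj.
  by rewrite /= nth_enum_ord.
split.
  exists (row ord_max Q).
    apply/eqP => r0; have : row ord_max Q *m Q^T = 0 by rewrite r0 mul0mx.
    rewrite -row_mul QQ => /rowP/(_ ord_max); rewrite !mxE eqxx => /eqP.
    by rewrite oner_eq0.
  have QM : Q *m M = diag_mx d *m Q by rewrite -Qd -mulmxA (mulmx1C QQ) mulmx1.
  by rewrite -row_mul QM row_mul row_diag_mx -scalemxAl -rowE lE.
move=> u; rewrite (quad_diag u QQ Qd) -(@sqnorm_orth _ Q^T u) ?trmxK ?(mulmx1C QQ) //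
  sqnorm_sum mulr_sumr.
by apply: ler_sum => i _; rewrite ler_wpM2r ?sqr_ge0 // lE dec // -ltnS.
Qed.

End Spectral.

(** * The Sylvester equation *)

Section Sylvester.
Variable R : realType.

Lemma horner_mx_coef n (C : 'M[R]_n.+1) (p : {poly R}) :
  horner_mx C p = \sum_(i < size p) p`_i *: C ^+ i.
Proof.
rewrite -{1}[p]coefK poly_def rmorph_sum; apply: eq_bigr => i _.
by rewrite /= horner_mxZ rmorphXn /= horner_mx_X.
Qed.

Section Krylov.
Variables (n : nat) (A B D T : 'M[R]_n.+1).
Hypothesis sylv : B *m T + T *m A = D.

(** A block Krylov space, kept as a row space: it will contain the rows of every T p(A) - p(- B) T
    with p of degree at most l. *)
Definition krylov l := (\sum_(b < l) <<D *m A ^+ b>>)%MS.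

Lemma rank_krylov l : (\rank (krylov l) <= \rank D * l)%N.
Proof.
rewrite /krylov mulnC; elim: l => [|l IH]; first by rewrite big_ord0 mxrank0.
rewrite big_ord_recr /= mulSn addnC (leq_trans (mxrank_adds_leqif _ _)) // leq_add //.
by rewrite genmxE mxrankM_maxl.
Qed.

Lemma sub_krylov l b : (b < l)%N -> (D *m A ^+ b <= krylov l)%MS.
Proof.
by move=> bl; rewrite (sumsmx_sup (Ordinal bl)) // genmxE.
Qed.

(** Since T A = D - B T, the difference for s + 1 is D A^s minus B times the difference for s, and
    left multiplication stays inside a row space. *)
Lemma krylov_power l s : (s <= l)%N -> (T *m A ^+ s - (- B) ^+ s *m T <= krylov l)%MS.
Proof.
elim: s => [|s IH] sl; first by rewrite !expr0 mulmx1 mul1mx subrr sub0mx.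
have -> : T *m A ^+ s.+1 - (- B) ^+ s.+1 *m T =
    D *m A ^+ s + (- B) *m (T *m A ^+ s - (- B) ^+ s *m T).
  rewrite -sylv !exprS !mulmxE mulrDl mulrBr !mulNr !mulrA !opprK.
  by rewrite [B * T * _ + _]addrC addrA addrK.
by rewrite addmx_sub ?sub_krylov // mulmx_sub // IH // ltnW.
Qed.

Lemma krylov_poly l (p : {poly R}) : (size p <= l.+1)%N ->
  (T *m horner_mx A p - horner_mx (- B) p *m T <= krylov l)%MS.
Proof.
move=> sp; rewrite !horner_mx_coef mulmx_sumr mulmx_suml -sumrB; apply: summx_sub => i _.
rewrite -scalemxAr -scalemxAl -scalerBr scalemx_sub // krylov_power //.
by rewrite -ltnS (leq_trans (ltn_ord i)).
Qed.

End Krylov.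

Lemma horner_mx_orth n (Q A : 'M[R]_n.+1) d (p : {poly R}) : Q *m Q^T = 1%:M ->
  Q *m A *m Q^T = diag_mx d -> horner_mx A p = Q^T *m diag_mx (map_mx (horner p) d) *m Q.
Proof.
move=> QQ Qd; have QTQ := mulmx1C QQ; rewrite -horner_mx_diag -Qd.
rewrite !horner_mx_coef mulmx_sumr mulmx_suml; apply: eq_bigr => i _;
  rewrite -scalemxAr -scalemxAl.
congr (_ *: _); elim: {i}(i : nat) => [|i IH]; first by rewrite !expr0 mulmx1 QTQ.
by rewrite !exprS -!mulmxE IH !mulmxA QTQ mul1mx.
Qed.

(** The matrix r is p(A) p(- A)^-1, diagonal in the basis [Q] with entries of modulus at most [M].
    It commutes with p(- A); the two factorisations serve the two sides of T. *)
Lemma rational_matrix n (A : 'M[R]_n.+1) (p : {poly R}) (M : R) (Q : 'M[R]_n.+1) d :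
  Q *m Q^T = 1%:M -> Q *m A *m Q^T = diag_mx d ->
  (forall i, p.[- d 0 i] != 0 /\ `|p.[d 0 i]| <= M * `|p.[- d 0 i]|) ->
  exists r, [/\ horner_mx A p = r *m horner_mx (- A) p, horner_mx A p = horner_mx (- A) p *m r,
     horner_mx (- A) p \in unitmx & forall u, sqnorm (u *m r) <= M ^+ 2 * sqnorm u].
Proof.
move=> QQ Qd H; have QTQ := mulmx1C QQ.
have QNd : Q *m (- A) *m Q^T = diag_mx (- d) by rewrite mulmxN mulNmx Qd raddfN.
rewrite (horner_mx_orth p QQ Qd) (horner_mx_orth p QQ QNd).
pose f (e : 'rV[R]_n.+1) := Q^T *m diag_mx e *m Q.
have fM e e' : f e *m f e' = f (\row_i (e 0 i * e' 0 i)).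
  rewrite /f !mulmxA -(mulmxA _ Q) QQ mulmx1 -(mulmxA Q^T) mulmx_diag //.
pose r := \row_i (p.[d 0 i] / p.[- d 0 i]); rewrite -!/(f _).
exists (f r); split.
- rewrite fM; congr f; apply/rowP => i; rewrite !mxE divfK //; by have [] := H i.
- rewrite fM; congr f; apply/rowP => i; rewrite !mxE mulrC divfK //; by have [] := H i.
- have : f (map_mx (horner p) (- d)) *m f (\row_i (p.[- d 0 i])^-1) = 1%:M.
    rewrite fM (_ : \row_i _ = const_mx 1) ?/f ?diag_const_mx ?mulmx1 //.
    apply/rowP => i; rewrite !mxE divff //; by have [] := H i.
  by case/mulmx1_unit.
- move=> u; rewrite /f !mulmxA sqnorm_orth // -(@sqnorm_orth _ _ Q^T u) ?trmxK //
  !sqnorm_sum mulr_sumr.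
  apply: ler_sum => i _; rewrite mul_mx_diag [X in X ^+ 2]mxE exprMn mulrC ler_wpM2r ?sqr_ge0 //.
  have [p0 pM] := H i; rewrite mxE -[_ ^+ 2]real_normK ?num_real // normf_div.
  have t0 : 0 < `|p.[- d 0 i]| by rewrite normr_gt0.
  rewrite ler_pXn2r ?nnegrE ?divr_ge0 // ?ler_pdivrMr //.
  by rewrite -(pmulr_lge0 _ t0) (le_trans _ pM).
Qed.

Lemma mul_pid_mxE n r (v : 'rV[R]_n) a :
  (v *m (pid_mx r : 'M[R]_n)) 0 a = v 0 a *+ (a < r)%N.
Proof.
rewrite mxE (bigD1 a) //= big1 ?addr0 => [|i ia].
  by rewrite mxE eqxx /= mulr_natr.
by rewrite mxE val_eqE (negbTE ia) mulr0.
Qed.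

Lemma rank_row_mx_leq m n1 n2 (A : 'M[R]_(m, n1)) (B : 'M[R]_(m, n2)) :
  (\rank (row_mx A B) <= \rank A + \rank B)%N.
Proof.
by rewrite -mxrank_tr tr_row_mx -addsmxE (leq_trans (mxrank_adds_leqif _ _)) // !mxrank_tr.
Qed.

(* A vector in the span of the top [j + r] singular vectors of [T], killed by
   the low rank part, and sent by [rB] to the orthogonal complement of the top
   [j - 1] singular vectors: fewer than [n] linear conditions. *)
Lemma sigma_perturbed n (T W rA rB : 'M[R]_n.+1) (M : R) (j r : nat) :
  T^T = T -> 0 <= M -> rB *m T *m rA = T + W -> (\rank W <= r)%N ->
  (forall u, sqnorm (u *m rA) <= M ^+ 2 * sqnorm u) ->
  (forall u, sqnorm (u *m rB) <= M ^+ 2 * sqnorm u) ->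
  (0 < j)%N -> (j + r <= n.+1)%N -> sigma T (j + r) <= M ^+ 2 * sigma T j.
Proof.
move=> symT M0 TW rW HA HB j0 jr; have [Q QQ [d Qd [dec d0 sE]]] := sing_vals_sorted T.
have QTQ := mulmx1C QQ.
have TT u : sqnorm (u *m T) = \sum_i d 0 i * (u *m Q^T) 0 i ^+ 2.
  by rewrite -(quad_diag u QQ Qd) /sqnorm trmx_mul symT !mulmxA.
have jn : (j.-1 < n.+1)%N by rewrite (leq_trans _ jr) // prednK // leq_addr.
have jrn : ((j + r).-1 < n.+1)%N by rewrite prednK // addn_gt0 j0.
(* The three conditions on [u] as one left kernel; the ranks add up to at most (n + 1 - (j + r)) + r
   + (j - 1) = n. *)
pose C := row_mx (row_mx (Q^T *m copid_mx (j + r)) W) (rB *m Q^T *m (pid_mx j.-1 : 'M[R]_n.+1)).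
have rC : (\rank C < n.+1)%N.
  rewrite /C (leq_ltn_trans (rank_row_mx_leq _ _)) //.
  have h1 : (\rank (Q^T *m copid_mx (j + r)) <= n.+1 - (j + r))%N.
    by rewrite (leq_trans (mxrankM_maxr _ _)) // rank_copid_mx.
  have h2 : (\rank (rB *m Q^T *m (pid_mx j.-1 : 'M[R]_n.+1)) <= j.-1)%N.
    by rewrite (leq_trans (mxrankM_maxr _ _)) // rank_pid_mx // ltnW.
  have h3 := rank_row_mx_leq (Q^T *m copid_mx (j + r)) W.
  rewrite (leq_ltn_trans (leq_add (leq_trans h3 (leq_add h1 rW)) h2)) //.
  by clear -j0 jr; lia.
have [u u0 uC] : exists2 u : 'rV[R]_n.+1, u != 0 & u *m C = 0.
  have : kermx C != 0 by rewrite kermx_eq0 -row_leq_rank -ltnNge.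
  case/rowV0Pn => u /sub_kermxP uC u0; by exists u.
move: uC; rewrite /C !mul_mx_row => /eqP;
  rewrite !row_mx_eq0 !mulmxA => /andP[/andP[/eqP u1 /eqP u2] /eqP u3].
have c1 (a : 'I_n.+1) : (j + r <= a)%N -> (u *m Q^T) 0 a = 0.
  move=> ja; have /rowP/(_ a) := u1; rewrite /copid_mx mulmxBr mulmx1 [LHS]mxE.
  by rewrite [X in _ + X]mxE mul_pid_mxE ltnNge ja mulr0n subr0 [RHS]mxE.
have c3 (a : 'I_n.+1) : (a < j.-1)%N -> (u *m rB *m Q^T) 0 a = 0.
  by move=> aj; have /rowP/(_ a) := u3; rewrite mul_pid_mxE aj mulr1n [RHS]mxE.
have low : d 0 (Ordinal jrn) * sqnorm u <= sqnorm (u *m T).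
  rewrite TT -(@sqnorm_orth _ _ Q^T u) ?trmxK // sqnorm_sum mulr_sumr; apply: ler_sum => a _.
  have [ja|ja] := leqP (j + r) a; first by rewrite c1 // expr0n !mulr0.
  by rewrite ler_wpM2r ?sqr_ge0 // dec //= -ltnS prednK // addn_gt0 j0.
have upp : sqnorm (u *m rB *m T) <= d 0 (Ordinal jn) * sqnorm (u *m rB).
  rewrite TT -(@sqnorm_orth _ _ Q^T (u *m rB)) ?trmxK // [X in _ <= _ * X]sqnorm_sum mulr_sumr.
  apply: ler_sum => a _.
  have [ja|ja] := ltnP a j.-1; first by rewrite c3 // expr0n !mulr0.
  by rewrite ler_wpM2r ?sqr_ge0 // dec.
have uT : u *m T = u *m rB *m T *m rA.
  by rewrite -!mulmxA (mulmxA rB) TW mulmxDr u2 addr0.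
have s0 := sqnorm_gt0 u0.
have key : d 0 (Ordinal jrn) <= (M ^+ 2) ^+ 2 * d 0 (Ordinal jn).
  have M2 : 0 <= M ^+ 2 by rewrite exprn_ge0.
  rewrite -(ler_pM2r s0); apply: le_trans low _; rewrite uT.
  apply: le_trans (HA _) _.
  have -> : (M ^+ 2) ^+ 2 * d 0 (Ordinal jn) * sqnorm u =
      M ^+ 2 * (d 0 (Ordinal jn) * (M ^+ 2 * sqnorm u)) by ring.
  by rewrite ler_wpM2l // (le_trans upp) // ler_wpM2l.
have := sE (Ordinal jn); rewrite /= prednK // => ->.
have := sE (Ordinal jrn); rewrite /= prednK ?addn_gt0 ?j0 // => ->.
rewrite -[M ^+ 2]ger0_norm ?exprn_ge0 // -sqrtr_sqr -sqrtrM ?exprn_ge0 //.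
by rewrite ler_wsqrtr.
Qed.
End Sylvester.

(** One polynomial serves both spectra. With W = rB T rA - T, the product p(- B) W p(- A) equals
    p(B) T p(A) - p(- B) T p(- A), whose rows lie in the Krylov space, and the outer factors are
    invertible, so W has rank at most l times that of D. *)
Lemma sylvester_sigma (R : realType) n (A B D T QA QB : 'M[R]_n.+1) (dA dB : 'rV[R]_n.+1)
    (a b : R) (j l : nat) :
  T^T = T -> B *m T + T *m A = D -> 0 < a -> a <= b ->
  QA *m QA^T = 1%:M -> QA *m A *m QA^T = diag_mx dA -> (forall i, a <= dA 0 i <= b) ->
  QB *m QB^T = 1%:M -> QB *m B *m QB^T = diag_mx dB -> (forall i, a <= dB 0 i <= b) ->
  (0 < j)%N -> (j + \rank D * l <= n.+1)%N ->
  sigma T (j + \rank D * l) <=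
    (2 * expR (- (l%:R * pi ^+ 2 / (2 * ln (4 * (b / a)))))) ^+ 2 * sigma T j.
Proof.
move=> symT sylv a0 ab QAQ QAd dAb QBQ QBd dBb j0 jl.
pose X := [seq dA 0 i | i <- enum 'I_n.+1] ++ [seq dB 0 i | i <- enum 'I_n.+1].
have Xab : all (fun x => a <= x <= b) X.
  by rewrite all_cat !all_map; apply/andP; split; apply/allP => i _ /=.
have [p sp pX] := zolotarev_polynomial l a0 ab Xab.
set M := 2 * expR _ in pX *.
have M0 : 0 <= M by rewrite mulr_ge0 // expR_ge0.
have HA i : p.[- dA 0 i] != 0 /\ `|p.[dA 0 i]| <= M * `|p.[- dA 0 i]|.
  by apply: pX; rewrite mem_cat map_f ?mem_enum.
have HB i : p.[- dB 0 i] != 0 /\ `|p.[dB 0 i]| <= M * `|p.[- dB 0 i]|.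
  by apply: pX; rewrite mem_cat orbC map_f ?mem_enum.
have [rA [pA _ uA nA]] := rational_matrix QAQ QAd HA.
have [rB [_ pB uB nB]] := rational_matrix QBQ QBd HB.
pose pN := p \Po (- 'X).
have pNE (C : 'M[R]_n.+1) : horner_mx C pN = horner_mx (- C) p.
  rewrite [RHS]horner_mx_coef /pN comp_polyE rmorph_sum; apply: eq_bigr => i _.
  by rewrite /= horner_mxZ rmorphXn rmorphN /= horner_mx_X.
have spN : (size pN <= l.+1)%N by rewrite /pN size_comp_poly2 // size_polyN size_polyX.
have k1 := krylov_poly sylv sp.
have k2 := krylov_poly sylv spN.
rewrite !pNE opprK in k2.
pose W := rB *m T *m rA - T.
have WE : horner_mx (- B) p *m W *m horner_mx (- A) p =
    horner_mx B p *m (T *m horner_mx A p - horner_mx (- B) p *m T) -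
    horner_mx (- B) p *m (T *m horner_mx (- A) p - horner_mx B p *m T).
  have cB : horner_mx B p *m horner_mx (- B) p = horner_mx (- B) p *m horner_mx B p.
    by rewrite -pNE !mulmxE -!rmorphM mulrC.
  rewrite /W !mulmxBr mulmxBl !mulmxA -pB -(mulmxA _ rA) -pA cB.
  by rewrite opprB addrA subrK.
have rW : (\rank W <= \rank D * l)%N.
  apply: leq_trans (rank_krylov A D l).
  have <- : \rank (horner_mx (- B) p *m W *m horner_mx (- A) p) = \rank W.
    by rewrite mxrankMfree ?row_free_unit // eqmxMfull // row_full_unit.
  by apply: mxrankS; rewrite WE addmx_sub ?eqmx_opp ?mulmx_sub.
apply: (@sigma_perturbed R n T W rA rB M) => //.
by rewrite /W subrKC.
Qed.

(** * Spectra of the two square roots and conclusion *)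

Lemma orth_row n (R : realType) (Q S : 'M[R]_n) (d : 'rV[R]_n) i : Q *m Q^T = 1%:M ->
  Q *m S *m Q^T = diag_mx d ->
  row i Q *m S = d 0 i *: row i Q /\ sqnorm (row i Q) = 1.
Proof.
move=> QQ Qd; split.
  have QS : Q *m S = diag_mx d *m Q by rewrite -Qd -mulmxA (mulmx1C QQ) mulmx1.
  by rewrite -row_mul QS row_mul row_diag_mx -scalemxAl -rowE.
rewrite rowE sqnorm_orth // sqnorm_sum (bigD1 i) //= mxE !eqxx expr1n big1 ?addr0 // => k ki.
by rewrite mxE (negbTE ki) andbF expr0n.
Qed.

Unset Implicit Arguments.

Theorem theorem3 (R : realType) (n k : nat) (A D SA SB : 'M[R]_n)
  (hA : spd A) (hB : spd (A + D)) (hk : \rank D = k)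
  (hSA : is_principal_sqrt SA A) (hSB : is_principal_sqrt SB (A + D))
  (j l : nat) (hj : (1 <= j)%N) (hjl : (j + k * l <= n)%N) :
  let Delta := SB - SA in
  let kappa := 2 * (Num.sqrt (norm2 A + norm2 D) + Num.sqrt (lambda_min A) / 2)
               / Num.sqrt (lambda_min A) in
  sigma Delta (j + k * l) <=
    4 * (expR (pi ^+ 2 / (2 * ln (4 * kappa)))) ^- (2 * l) * sigma Delta j.
Proof.
cbv zeta.
case: n A D SA SB hA hB hk hSA hSB hjl => [|n] A D SA SB hA hB hk hSA hSB hjl.
  by move: hj hjl; rewrite leqn0 addn_eq0; case: (j).
set kappa := _ / Num.sqrt (lambda_min A).
have [symA posA] := hA; have [[symSA psdSA] SA2] := hSA; have [[symSB psdSB] SB2] := hSB.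
have [[v v0 vA] lmin] := lambda_min_bound symA.
set lam := lambda_min A in vA lmin kappa *.
have lam0 : 0 < lam.
  have vt : v^T != 0 by apply: contra v0 => /eqP h; rewrite -[v]trmxK h trmx0.
  have := posA _ vt; rewrite trmxK vA -scalemxAl mxE pmulr_lgt0 //.
  exact: sqnorm_gt0.
have [QA QAQ [dA QAd]] := symmetric_spectral symSA.
have [QB QBQ [dB QBd]] := symmetric_spectral symSB.
set s := Num.sqrt lam in kappa *.
have s0 : 0 < s by rewrite sqrtr_gt0.
have s2 : s ^+ 2 = lam by rewrite sqr_sqrtr // ltW.
set t := Num.sqrt (norm2 A + norm2 D) in kappa *.
have nA0 := norm2_ge0 A; have nD0 := norm2_ge0 D.
have t0 : 0 <= t by rewrite sqrtr_ge0.
have t2 : t ^+ 2 = norm2 A + norm2 D by rewrite sqr_sqrtr // addr_ge0.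
have dA0 i : 0 <= dA 0 i.
  have [e n1] := orth_row i QAQ QAd; have := psdSA (row i QA)^T.
  by rewrite trmxK e -scalemxAl mxE -/(sqnorm _) n1 mulr1.
have dB0 i : 0 <= dB 0 i.
  have [e n1] := orth_row i QBQ QBd; have := psdSB (row i QB)^T.
  by rewrite trmxK e -scalemxAl mxE -/(sqnorm _) n1 mulr1.
(* An eigenvalue of [SA], squared, is a Rayleigh quotient of [A], hence lies between [lam] and the
   norm of [A]. *)
have dAs i : s <= dA 0 i <= t.
  have [e n1] := orth_row i QAQ QAd; set q := row i QA in e n1.
  have qA : (q *m A *m q^T) 0 0 = dA 0 i ^+ 2.
    by rewrite -SA2 mulmxA e -scalemxAl e scalerA -scalemxAl mxE -/(sqnorm _) n1 mulr1 expr2.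
  have h1 := lmin q; have h2 := quad_le_norm2 A q.
  rewrite qA n1 mulr1 in h1 h2.
  rewrite -(@ler_pXn2r _ 2 _ s) ?nnegrE ?(ltW s0) // s2 h1 /=.
  have h3 : dA 0 i ^+ 2 <= t ^+ 2 by rewrite t2; lra.
  by rewrite ler_pXn2r ?nnegrE // in h3.
have dBt i : dB 0 i <= t.
  have [e n1] := orth_row i QBQ QBd; set q := row i QB in e n1.
  have qA : (q *m A *m q^T) 0 0 + (q *m D *m q^T) 0 0 = dB 0 i ^+ 2.
    have <- : (q *m (A + D) *m q^T) 0 0 = (q *m A *m q^T) 0 0 + (q *m D *m q^T) 0 0.
      by rewrite mulmxDr mulmxDl mxE.
    by rewrite -SB2 mulmxA e -scalemxAl e scalerA -scalemxAl mxE -/(sqnorm _) n1 mulr1 expr2.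
  have h1 := quad_le_norm2 D q; have h2 := quad_le_norm2 A q.
  rewrite n1 mulr1 in h1 h2.
  have h3 : dB 0 i ^+ 2 <= t ^+ 2 by rewrite t2 -qA; lra.
  by rewrite ler_pXn2r ?nnegrE // in h3.
(* The shift balances the two spectra: [0, t] + a and [s, t] - a both start at a = s / 2 and lie in
   [a, b]. *)
pose a := s / 2; pose b := t + a.
have a0 : 0 < a by rewrite divr_gt0.
have shift (Q S : 'M[R]_n.+1) d c : Q *m Q^T = 1%:M -> Q *m S *m Q^T = diag_mx d ->
    Q *m (S + c%:M) *m Q^T = diag_mx (d + const_mx c).
  move=> QQ Qd; rewrite mulmxDr mulmxDl Qd mul_mx_scalar -scalemxAl QQ.
  by rewrite raddfD /= diag_const_mx scale_scalar_mx mulr1.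
(* The scalar shifts cancel, and the mixed products leave SB^2 - SA^2 = D. *)
have sylv : (SA + (- a)%:M) *m (SB - SA) + (SB - SA) *m (SB + a%:M) = D.
  rewrite !(mulmxDl, mulmxDr, mulmxN, mulNmx) SA2 SB2 !mul_scalar_mx !mul_mx_scalar.
  move: (SA *m SB) => P; apply/matrixP => x y; rewrite !mxE; ring.
have main := @sylvester_sigma R n (SB + a%:M) (SA + (- a)%:M) D (SB - SA) QB QA
   (dB + const_mx a) (dA + const_mx (- a)) a b j l.
have kE : kappa = b / a by rewrite /kappa /b /a; field; rewrite gt_eqF.
rewrite -hk in hjl *; rewrite kE.
apply: le_trans (main _ sylv a0 _ QBQ (shift _ _ _ _ QBQ QBd) _ QAQ
  (shift _ _ _ _ QAQ QAd) _ hj hjl) _.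
- by rewrite raddfB /= symSB symSA.
- by rewrite /b lerDr.
- by move=> i; rewrite !mxE /b lerDr dB0 /= lerD2r dBt.
- move=> i; rewrite !mxE; have /andP[h1 h2] := dAs i; rewrite /b /a; apply/andP; split; lra.
(* Squaring 2 exp(...) produces the factor 4 and turns l into 2 l. *)
rewrite le_eqVlt; apply/orP; left; apply/eqP; congr (_ * _).
rewrite exprMn -[expR _ ^+ (2 * l)]expRM_natl -expRN -[expR _ ^+ 2]expRM_natl.
rewrite (_ : 2 ^+ 2 = 4 :> R); last by ring.
congr (4 * expR _); rewrite natrM; ring.
Qed.
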